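(* Fix $L\in\mathbb{N}$, $\rho,\lambda_\sigma,\alpha,\beta>0$, $\tau\ge0$, $\eta\ge1$. There exists $c>0$ depending only on $L,\rho,\lambda_\sigma,\tau,\alpha,\beta,\eta$ such that whenever: (1) $\mathbf{X}$ satisfies the subgaussian concentration property with constant $\rho$; (2) $X$ and $W_\ell,B_\ell$, $\ell=0,\dots,L-1$, are centered; (3) each $\sigma_\ell$ is $\lambda_\sigma$-Lipschitz and $|\sigma_\ell(0)|\le\tau$; (4) $n/n_\ell\le\alpha$ for $\ell=1,\dots,L$; (5) $n_{\ell-1}/n_\ell\le\beta$ for $\ell=1,\dots,L$; (6) $n_0\ge\eta$; then for every $F\colon\mathbb{R}^{n_L\times n}\to\mathbb{R}$ that is $1$-Lipschitz with respect to the Hilbert--Schmidt norm and every $t>0$, $$\mathbb{P}(|F(Z_L)-\mathrm{Med}\,F(Z_L)|\ge t)\le2\exp\Big(-c\min_{1\le k\le L+1}n^{(k-1)/k}t^{2/k}\Big).$$ If in addition $\sup_x|\sigma_{L-1}(x)|\le\kappa$, then for such $F$ and all $t>0$, $$\mathbb{P}(|F(Z_L)-\mathrm{Med}\,F(Z_L)|\ge t)\le2\exp(-c't^2)$$ for some $c'>0$ depending only on $L,\rho,\lambda_\sigma,\tau,\kappa,\alpha,\beta,\eta$. Moreover, if $\alpha\to0$ and $\eta\to\infty$ simultaneously while the other parameters are fixed, the optimal (largest) constants $c_{opt},c'_{opt}$ for which these inequalities hold for all models satisfying the assumptions diverge to $\infty$.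
   Context: Model: $L,n_0,\dots,n_L,n$ positive integers; $X$ an $n_0\times n$ random matrix, $W_\ell$ an $n_{\ell+1}\times n_\ell$ random matrix, $B_\ell$ a random vector in $\mathbb{R}^{n_{\ell+1}}$, $\sigma_\ell\colon\mathbb{R}\to\mathbb{R}$, $\ell=0,\dots,L-1$; functions act on matrices entrywise. $Z_0=n_0^{-1/2}X$, $Z_{\ell+1}=n_{\ell+1}^{-1/2}\sigma_\ell(W_\ell Z_\ell+B_\ell\mathbf{1}_n^T)$, $\mathbf{1}_n$ the all-ones vector of $\mathbb{R}^n$. $\mathbf{X}=(X,(W_\ell,B_\ell)_{\ell=0}^{L-1})$ is viewed as a random vector in $\mathbb{R}^N$, $N=nn_0+\sum_\ell(n_\ell n_{\ell+1}+n_{\ell+1})$. Subgaussian concentration property with constant $\rho$: for every Euclidean $1$-Lipschitz $F\colon\mathbb{R}^N\to\mathbb{R}$ and $t>0$, $\mathbb{P}(|F(\mathbf{X})-\mathrm{Med}\,F(\mathbf{X})|\ge t)\le2e^{-t^2/\rho^2}$, $\mathrm{Med}$ any median. Centered means all entries have mean zero. Hilbert--Schmidt norm: $\|x\|_{HS}=(\sum_{ij}x_{ij}^2)^{1/2}$. *)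

(* Defs.v *)
From HB Require Import structures.
From mathcomp Require Import all_boot all_order all_algebra.
From mathcomp Require Import all_classical all_reals all_analysis.
Set Implicit Arguments. Unset Strict Implicit. Unset Printing Implicit Defensive.
Import Order.TTheory GRing.Theory Num.Theory.
Local Open Scope classical_set_scope.
Local Open Scope ring_scope.

Definition hs2 (R : realType) p q (A : 'M[R]_(p, q)) : R :=
  \sum_(i < p) \sum_(j < q) A i j ^+ 2.
Definition hsnorm (R : realType) p q (A : 'M[R]_(p, q)) : R := Num.sqrt (hs2 A).

Fixpoint Zl (R : realType) (n : nat) (ns : nat -> nat) (sigma : nat -> R -> R)
  (X : 'M[R]_(ns 0, n)) (W : forall l : nat, 'M[R]_(ns l.+1, ns l))
  (B : forall l : nat, 'cV[R]_(ns l.+1)) (l : nat) : 'M[R]_(ns l, n) :=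
  match l as l0 return 'M[R]_(ns l0, n) with
  | 0 => (Num.sqrt (ns 0)%:R)^-1 *: X
  | l'.+1 => (Num.sqrt (ns l'.+1)%:R)^-1 *:
       map_mx (sigma l') (W l' *m Zl sigma X W B l' + B l' *m const_mx 1)
  end.

Definition Params (R : realType) (L n : nat) (ns : nat -> nat) : Type :=
  ('M[R]_(ns 0, n) * (forall l : 'I_L, 'M[R]_(ns l.+1, ns l) * 'cV[R]_(ns l.+1)))%type.

(* Euclidean distance on R^N, N = n n_0 + sum_l (n_l n_{l+1} + n_{l+1}),
   written out on the parameter tuple *)
Definition params_dist (R : realType) (L n : nat) (ns : nat -> nat)
  (p q : Params R L n ns) : R :=
  Num.sqrt (hs2 (p.1 - q.1) +
            \sum_(l < L) (hs2 ((p.2 l).1 - (q.2 l).1) + hs2 ((p.2 l).2 - (q.2 l).2))).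

Definition is_median (R : realType) d (Omega : measurableType d)
  (P : probability Omega R) (Y : Omega -> R) (m : R) : Prop :=
  ((1/2)%:E <= P [set w | (Y w <= m)%R])%E /\ ((1/2)%:E <= P [set w | (m <= Y w)%R])%E.

Definition subgauss_conc (R : realType) d (Omega : measurableType d)
  (P : probability Omega R) (T : Type) (dist : T -> T -> R) (Y : Omega -> T)
  (rho : R) : Prop :=
  forall F : T -> R, (forall p q, `|F p - F q| <= dist p q) ->
  forall m, is_median P (fun w => F (Y w)) m ->
  forall t, 0 < t ->
    (P [set w | (t <= `|F (Y w) - m|)%R] <= (2 * expR (- (t ^+ 2 / rho ^+ 2)))%:E)%E.

Definition centered_rv (R : realType) d (Omega : measurableType d)
  (P : probability Omega R) (f : Omega -> R) : Prop :=
  P.-integrable setT (fun w => (f w)%:E) /\ (\int[P]_w (f w)%:E)%E = 0%E.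

Definition model_assumptions (R : realType) (L : nat)
  (rho lam tau alpha beta eta : R)
  d (Omega : measurableType d) (P : probability Omega R)
  (n : nat) (ns : nat -> nat)
  (X : Omega -> 'M[R]_(ns 0, n))
  (W : forall l : nat, Omega -> 'M[R]_(ns l.+1, ns l))
  (B : forall l : nat, Omega -> 'cV[R]_(ns l.+1))
  (sigma : nat -> R -> R) : Prop :=
  (0 < n)%N /\ (forall l, (l <= L)%N -> (0 < ns l)%N) /\
  (forall i j, measurable_fun setT (fun w => X w i j)) /\
  (forall l, (l < L)%N ->
      (forall i j, measurable_fun setT (fun w => W l w i j)) /\
      (forall i j, measurable_fun setT (fun w => B l w i j))) /\
  subgauss_conc P (@params_dist R L n ns)
    (fun w => (X w, fun l : 'I_L => (W l w, B l w))) rho /\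
  (forall i j, centered_rv P (fun w => X w i j)) /\
  (forall l, (l < L)%N ->
      (forall i j, centered_rv P (fun w => W l w i j)) /\
      (forall i j, centered_rv P (fun w => B l w i j))) /\
  (forall l, (l < L)%N ->
      (forall x y, `|sigma l x - sigma l y| <= lam * `|x - y|) /\
      `|sigma l 0| <= tau) /\
  (forall l, (0 < l <= L)%N -> n%:R / (ns l)%:R <= alpha) /\
  (forall l, (0 < l <= L)%N -> (ns l.-1)%:R / (ns l)%:R <= beta) /\
  eta <= (ns 0)%:R.

Definition ZL (R : realType) (L : nat) d (Omega : measurableType d)
  (n : nat) (ns : nat -> nat)
  (X : Omega -> 'M[R]_(ns 0, n))
  (W : forall l : nat, Omega -> 'M[R]_(ns l.+1, ns l))
  (B : forall l : nat, Omega -> 'cV[R]_(ns l.+1))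
  (sigma : nat -> R -> R) (w : Omega) : 'M[R]_(ns L, n) :=
  Zl sigma (X w) (fun l => W l w) (fun l => B l w) L.

(* min_{1 <= k <= L+1} n^{(k-1)/k} t^{2/k}  (index k = i+1, i < L+1;
   the seed t^2 is the k = 1 term) *)
Definition minexp (R : realType) (L n : nat) (t : R) : R :=
  \big[Num.min/ t ^+ 2]_(i < L.+1)
     ((n%:R `^ (i%:R / i.+1%:R)) * (t `^ (2 / i.+1%:R))).

Definition tail_bound (R : realType) (L : nat) d (Omega : measurableType d)
  (P : probability Omega R) (n : nat) (ns : nat -> nat)
  (X : Omega -> 'M[R]_(ns 0, n))
  (W : forall l : nat, Omega -> 'M[R]_(ns l.+1, ns l))
  (B : forall l : nat, Omega -> 'cV[R]_(ns l.+1))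
  (sigma : nat -> R -> R) (rate : R -> R) : Prop :=
  forall F : 'M[R]_(ns L, n) -> R,
    (forall x y, `|F x - F y| <= hsnorm (x - y)) ->
  forall m, is_median P (fun w => F (ZL L X W B sigma w)) m ->
  forall t, 0 < t ->
    (P [set w | (t <= `|F (ZL L X W B sigma w) - m|)%R]
       <= (2 * expR (- rate t))%:E)%E.

Definition valid_c (R : realType) (L : nat) (rho lam tau alpha beta eta c : R)
  : Prop :=
  forall d (Omega : measurableType d) (P : probability Omega R)
    (n : nat) (ns : nat -> nat) (X : Omega -> 'M[R]_(ns 0, n))
    (W : forall l : nat, Omega -> 'M[R]_(ns l.+1, ns l))
    (B : forall l : nat, Omega -> 'cV[R]_(ns l.+1)) (sigma : nat -> R -> R),
  model_assumptions L rho lam tau alpha beta eta P X W B sigma ->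
  tail_bound L P X W B sigma (fun t => c * minexp L n t).

Definition valid_c' (R : realType) (L : nat)
  (rho lam tau kappa alpha beta eta c' : R) : Prop :=
  forall d (Omega : measurableType d) (P : probability Omega R)
    (n : nat) (ns : nat -> nat) (X : Omega -> 'M[R]_(ns 0, n))
    (W : forall l : nat, Omega -> 'M[R]_(ns l.+1, ns l))
    (B : forall l : nat, Omega -> 'cV[R]_(ns l.+1)) (sigma : nat -> R -> R),
  model_assumptions L rho lam tau alpha beta eta P X W B sigma ->
  ((0 < L)%N -> forall x, `|sigma L.-1 x| <= kappa) ->
  tail_bound L P X W B sigma (fun t => c' * t ^+ 2).

(* Main.v *)
Require Import Defs.
From HB Require Import structures.
From mathcomp Require Import all_boot all_order all_algebra.
From mathcomp Require Import all_classical all_reals all_analysis.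
From mathcomp Require Import measurable_realfun ring lra.
Set Implicit Arguments. Unset Strict Implicit. Unset Printing Implicit Defensive.
Import Order.TTheory GRing.Theory Num.Theory.
Local Open Scope classical_set_scope.
Local Open Scope ring_scope.

(** Let [delta^2] dominate [alpha] and [1 / eta]. On the set of parameters where
    [|W_l|_op <= K sqrt n_(l+1)], [|B_l| <= K sqrt n_(l+1)] and
    [|X|_HS <= K sqrt (n n_0)], the map from parameters to [Z_L] is
    [C delta K^L]-Lipschitz: the factor [delta] is the size of [sqrt (n / n_l)] and
    [1 / sqrt n_0], and [|Z_l|_HS <= C K^(l+1) sqrt n]. A centered 1-Lipschitz function
    has second moment at most [65 rho^2], so each [|W_l v|] is concentrated below
    [C rho sqrt n_(l+1)], and a union bound over a net of at most [64^(n_l)] points [v]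
    shows that for [K] large this set has complement of probability at most
    [C exp (- c K^2 n / delta^2)]. Concentration applied to a McShane extension of
    [F] from it, with [K^(2(L+1)) ~ max (1, t^2 / n)], gives the first bound with a
    constant of order [delta^-2], hence also its divergence. If the last activation is
    bounded by [kappa], then [F (Z_L)] stays within [2 kappa sqrt n] of its median, and
    for [t] below this threshold [minexp] is at least a multiple of [t^2]. *)

(** * Euclidean norm of finite families *)

Section L2norm.
Variables (R : realType) (I : finType).
Implicit Types f g : I -> R.

Definition l2 f : R := Num.sqrt (\sum_i f i ^+ 2).

Lemma sumsq_ge0 f : 0 <= \sum_i f i ^+ 2.
Proof. by apply: sumr_ge0 => i _; exact: sqr_ge0. Qed.

Lemma l2_ge0 f : 0 <= l2 f. Proof. exact: sqrtr_ge0. Qed.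

Lemma sqr_l2 f : l2 f ^+ 2 = \sum_i f i ^+ 2.
Proof. by rewrite sqr_sqrtr // sumsq_ge0. Qed.

Lemma eq_l2 f g : f =1 g -> l2 f = l2 g.
Proof. by move=> fg; rewrite /l2; under eq_bigr do rewrite fg. Qed.

Lemma normr_le_l2 f i : `|f i| <= l2 f.
Proof.
rewrite -sqrtr_sqr ler_wsqrtr // (bigD1 i) //= lerDl.
by apply: sumr_ge0 => j _; exact: sqr_ge0.
Qed.

Lemma l2_eq0 f : l2 f = 0 -> forall i, f i = 0.
Proof.
by move=> f0 i; apply/eqP; rewrite -normr_le0 -f0 normr_le_l2.
Qed.

Lemma cauchy_schwarz f g : \sum_i f i * g i <= l2 f * l2 g.
Proof.
have [f0|fn0] := eqVneq (l2 f) 0.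
  rewrite f0 mul0r big1 // => i _; by rewrite (l2_eq0 f0) mul0r.
have [g0|gn0] := eqVneq (l2 g) 0.
  rewrite g0 mulr0 big1 // => i _; by rewrite (l2_eq0 g0) mulr0.
have fp : 0 < l2 f by rewrite lt0r fn0 l2_ge0.
have gp : 0 < l2 g by rewrite lt0r gn0 l2_ge0.
(* With this weight the bound [(c |f|^2 + |g|^2 / c) / 2] given by AM-GM equals [|f| |g|]. *)
set c := l2 g / l2 f.
have cp : 0 < c by rewrite divr_gt0.
have step i : f i * g i <= (c * f i ^+ 2 + c^-1 * g i ^+ 2) / 2.
  have h := sqr_ge0 (c * f i - g i).
  rewrite ler_pdivlMr // -(ler_pM2l cp).
  have hc : c * c^-1 = 1 by rewrite divff ?gt_eqF.
  have -> : c * (c * f i ^+ 2 + c^-1 * g i ^+ 2) = c * c * f i ^+ 2 + c / c * g i ^+ 2.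
    by ring.
  by rewrite hc mul1r; nra.
apply: le_trans (ler_sum _ (fun i _ => step i)) _.
rewrite -mulr_suml big_split /= -!mulr_sumr -!sqr_l2 /c.
by rewrite le_eqVlt; apply/orP; left; apply/eqP; field; rewrite fn0 gn0.
Qed.

Lemma ler_l2D f g : l2 (fun i => f i + g i) <= l2 f + l2 g.
Proof.
rewrite -(@ler_pXn2r _ 2) ?nnegrE ?addr_ge0 ?l2_ge0 //.
rewrite sqr_l2 sqrrD !sqr_l2.
under eq_bigr do rewrite sqrrD.
by rewrite !big_split /= lerD2r lerD2l mulr2n lerD ?cauchy_schwarz.
Qed.

Lemma l2Z a f : l2 (fun i => a * f i) = `|a| * l2 f.
Proof.
rewrite /l2; under eq_bigr do rewrite exprMn.
by rewrite -mulr_sumr sqrtrM ?sqr_ge0 // sqrtr_sqr.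
Qed.

Lemma l2N f : l2 (fun i => - f i) = l2 f.
Proof. by rewrite /l2; under eq_bigr do rewrite sqrrN. Qed.

Lemma ler_l2B f g : `|l2 f - l2 g| <= l2 (fun i => f i - g i).
Proof.
rewrite ler_distl; apply/andP; split.
  rewrite lerBlDr.
  have -> : l2 (fun i => f i - g i) = l2 (fun i => g i - f i).
    by rewrite -l2N; apply: eq_l2 => i; rewrite opprB.
  apply: le_trans (ler_l2D _ _); rewrite le_eqVlt; apply/orP; left; apply/eqP.
  by apply: eq_l2 => i; rewrite addrC subrK.
rewrite addrC.
apply: le_trans (ler_l2D _ _); rewrite le_eqVlt; apply/orP; left; apply/eqP.
by apply: eq_l2 => i; rewrite subrK.
Qed.

Lemma ler_l2 f g : (forall i, `|f i| <= `|g i|) -> l2 f <= l2 g.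
Proof.
move=> fg; apply: ler_wsqrtr; apply: ler_sum => i _.
by rewrite -(real_normK (num_real (f i))) -(real_normK (num_real (g i))) ler_pXn2r ?nnegrE.
Qed.

Lemma l2_le_bound f (e : R) : 0 <= e -> (forall i, `|f i| <= e) ->
  l2 f <= Num.sqrt #|I|%:R * e.
Proof.
move=> e0 fe; have -> : Num.sqrt #|I|%:R * e = l2 (fun=> e).
  by rewrite /l2 sumr_const -(mulr_natl (e ^+ 2)) sqrtrM ?ler0n // sqrtr_sqr ger0_norm.
by apply: ler_l2 => i; rewrite (ger0_norm e0).
Qed.

End L2norm.

(** * Hilbert-Schmidt norm, products and entrywise Lipschitz maps *)

Section HS.
Variable R : realType.

Lemma hsnormE p q (A : 'M[R]_(p, q)) : hsnorm A = l2 (fun ij => A ij.1 ij.2).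
Proof. by rewrite /hsnorm /hs2 pair_big. Qed.

Lemma hs2_ge0 p q (A : 'M[R]_(p, q)) : 0 <= hs2 A.
Proof. by rewrite /hs2 pair_big sumsq_ge0. Qed.

Lemma sqr_hsnorm p q (A : 'M[R]_(p, q)) : hsnorm A ^+ 2 = hs2 A.
Proof. by rewrite sqr_sqrtr // hs2_ge0. Qed.

Lemma hsnorm_ge0 p q (A : 'M[R]_(p, q)) : 0 <= hsnorm A.
Proof. exact: sqrtr_ge0. Qed.

Lemma ler_hsnormD p q (A B : 'M[R]_(p, q)) : hsnorm (A + B) <= hsnorm A + hsnorm B.
Proof.
rewrite !hsnormE; apply: le_trans (ler_l2D _ _).
by rewrite (eq_l2 (g := fun ij => A ij.1 ij.2 + B ij.1 ij.2)) // => ij; rewrite mxE.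
Qed.

Lemma hsnormZ p q a (A : 'M[R]_(p, q)) : hsnorm (a *: A) = `|a| * hsnorm A.
Proof. by rewrite !hsnormE -l2Z; apply: eq_l2 => ij; rewrite mxE. Qed.

Lemma hsnormN p q (A : 'M[R]_(p, q)) : hsnorm (- A) = hsnorm A.
Proof. by rewrite -scaleN1r hsnormZ normrN1 mul1r. Qed.

Lemma hsnorm0 p q : hsnorm (0 : 'M[R]_(p, q)) = 0.
Proof. by rewrite -(scale0r 0) hsnormZ normr0 mul0r. Qed.

Lemma hs2_col p q (A : 'M[R]_(p, q)) : hs2 A = \sum_j hs2 (col j A).
Proof.
rewrite /hs2 exchange_big; apply: eq_bigr => j _; apply: eq_bigr => i _.
by rewrite big_ord1 mxE.
Qed.

Lemma hsnorm_cvE p (v : 'cV[R]_p) : hsnorm v = l2 (fun i => v i 0).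
Proof. by rewrite /hsnorm /hs2 /l2; congr Num.sqrt; apply: eq_bigr => i _; rewrite big_ord1. Qed.

(** The squared Hilbert-Schmidt norm is a sum over columns, and the operator bound applies to each
    column of [B]. *)
Lemma hsnorm_mul_op p q r (A : 'M[R]_(p, q)) (B : 'M[R]_(q, r)) (k : R) : 0 <= k ->
  (forall v : 'cV[R]_q, hsnorm (A *m v) <= k * hsnorm v) ->
  hsnorm (A *m B) <= k * hsnorm B.
Proof.
move=> k0 H.
rewrite -(@ler_pXn2r _ 2) ?nnegrE ?mulr_ge0 ?hsnorm_ge0 //.
rewrite exprMn !sqr_hsnorm hs2_col [in leRHS]hs2_col mulr_sumr.
apply: ler_sum => j _; rewrite -!sqr_hsnorm -exprMn ler_pXn2r ?nnegrE ?mulr_ge0 ?hsnorm_ge0 //.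
by rewrite !colE -mulmxA.
Qed.

Lemma hsnorm_mulv p q (A : 'M[R]_(p, q)) (v : 'cV[R]_q) :
  hsnorm (A *m v) <= hsnorm A * hsnorm v.
Proof.
rewrite -(@ler_pXn2r _ 2) ?nnegrE ?mulr_ge0 ?hsnorm_ge0 //.
rewrite exprMn !sqr_hsnorm {1 2}/hs2 mulr_suml; apply: ler_sum => i _.
rewrite big_ord1 mxE -sqr_hsnorm hsnorm_cvE.
have -> : \sum_j A i j ^+ 2 = l2 (A i) ^+ 2 by rewrite sqr_l2.
rewrite -exprMn -[leLHS](real_normK (num_real _)).
rewrite ler_pXn2r ?nnegrE ?mulr_ge0 ?l2_ge0 // ler_norml cauchy_schwarz andbT.
rewrite lerNl -sumrN -(l2N (fun j => v j 0)).
by under eq_bigr do rewrite -mulrN; exact: cauchy_schwarz.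
Qed.

Lemma hsnorm_mul p q r (A : 'M[R]_(p, q)) (B : 'M[R]_(q, r)) :
  hsnorm (A *m B) <= hsnorm A * hsnorm B.
Proof. by apply: hsnorm_mul_op (hsnorm_ge0 _) _ => v; exact: hsnorm_mulv. Qed.

Lemma hsnorm_const p q (a : R) : hsnorm (const_mx a : 'M[R]_(p, q)) = Num.sqrt (p * q)%:R * `|a|.
Proof.
rewrite hsnormE /l2; under eq_bigr do rewrite mxE.
rewrite sumr_const card_prod !card_ord -(mulr_natl (a ^+ 2)) sqrtrM ?ler0n //.
by rewrite sqrtr_sqr.
Qed.

Lemma hsnorm_map_lip p q (s : R -> R) (lam : R) (A B : 'M[R]_(p, q)) : 0 <= lam ->
  (forall x y, `|s x - s y| <= lam * `|x - y|) ->
  hsnorm (map_mx s A - map_mx s B) <= lam * hsnorm (A - B).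
Proof.
move=> l0 H; have -> : lam * hsnorm (A - B) = hsnorm (lam *: (A - B)).
  by rewrite hsnormZ ger0_norm.
rewrite !hsnormE; apply: ler_l2 => ij.
by rewrite !mxE normrM (ger0_norm l0) H.
Qed.

Lemma hsnorm_map_le p q (s : R -> R) (lam tau : R) (A : 'M[R]_(p, q)) : 0 <= lam ->
  (forall x y, `|s x - s y| <= lam * `|x - y|) -> `|s 0| <= tau ->
  hsnorm (map_mx s A) <= lam * hsnorm A + Num.sqrt (p * q)%:R * tau.
Proof.
move=> l0 H s0; rewrite -(subrK (map_mx s 0) (map_mx s A)).
apply: le_trans (ler_hsnormD _ _) _; apply: lerD.
  by apply: le_trans (hsnorm_map_lip _ _ l0 H) _; rewrite subr0.
have -> : map_mx s (0 : 'M[R]_(p, q)) = const_mx (s 0).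
  by apply/matrixP=> i j; rewrite !mxE.
by rewrite hsnorm_const ler_wpM2l ?sqrtr_ge0.
Qed.

End HS.

(* Net of the unit ball: points z / (2 sqrt c) with z in Z^c, |z|_2^2 <= 4 c. *)
Section Net.
Variables (R : realType) (c : nat).

(** An integer is coded by a sign and a magnitude. Magnitudes up to [4 * c] suffice because
    [k <= k ^ 2]; zero has two codes, which only increases the count. *)
Definition net_index := {ffun 'I_c -> bool * 'I_(4 * c).+1}.

Definition net_good : {pred net_index} :=
  [pred z : net_index | (\sum_i (z i).2 ^ 2 <= 4 * c)%N].

Definition net_pt (z : net_index) : 'cV[R]_c :=
  \col_i ((-1) ^+ (z i).1 * ((z i).2 : nat)%:R / (2 * Num.sqrt c%:R)).

Lemma sqrt_nat_gt0 n : (0 < n)%N -> 0 < Num.sqrt n%:R :> R.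
Proof. by move=> n0; rewrite sqrtr_gt0 ltr0n. Qed.

Lemma sqr_sqrt_nat n : Num.sqrt n%:R ^+ 2 = n%:R :> R.
Proof. by rewrite sqr_sqrtr // ler0n. Qed.

Lemma net_pt_norm z : (0 < c)%N -> z \in net_good -> hsnorm (net_pt z) <= 1.
Proof.
move=> c0; rewrite inE => zg.
have sc := sqrt_nat_gt0 c0.
rewrite -(@ler_pXn2r _ 2) ?nnegrE ?hsnorm_ge0 //.
rewrite hsnorm_cvE sqr_l2 expr1n.
have E i : net_pt z i 0 ^+ 2 = (((z i).2 : nat) ^ 2)%:R / (4 * c%:R).
  rewrite mxE !exprMn -exprM mulnC exprM sqrrN expr1n expr1n mul1r exprVn exprMn.
  by rewrite sqr_sqrt_nat natrX; congr (_ / (_ * _)); rewrite expr2 -natrM.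
under eq_bigr do rewrite E.
rewrite -mulr_suml ler_pdivrMr ?mulr_gt0 ?ltr0n // mul1r -natr_sum -natrM ler_nat.
exact: zg.
Qed.

(** Each coordinate is rounded toward zero on a grid of step [1 / (2 sqrt c)]. Rounding does not
    increase magnitudes, so the result stays in [net_good], and [c] errors of at most one step have
    norm at most 1/2. *)
Lemma net_cover (v : 'cV[R]_c) : (0 < c)%N -> hsnorm v <= 1 ->
  exists2 z, z \in net_good & hsnorm (v - net_pt z) <= 2^-1.
Proof.
move=> c0 v1; have sc := sqrt_nat_gt0 c0.
pose a i := 2 * Num.sqrt c%:R * `|v i 0|.
have a0 i : 0 <= a i by rewrite !mulr_ge0 ?sqrtr_ge0.
pose k i := Num.truncn (a i).
have k_le i : (k i)%:R <= a i by rewrite /k; have /andP[] := truncn_itv (a0 i).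
have k_gt i : a i < (k i).+1%:R by rewrite /k; have /andP[] := truncn_itv (a0 i).
have suma : \sum_i a i ^+ 2 <= (4 * c)%:R.
  under eq_bigr do rewrite /a !exprMn sqr_sqrt_nat real_normK ?num_real //.
  rewrite -mulr_sumr natrM.
  have -> : 2 ^+ 2 = 4%:R :> R by rewrite -natrX.
  apply: ler_piMr; first by rewrite -natrM ler0n.
  rewrite -sqr_l2 -hsnorm_cvE; rewrite expr_le1 ?hsnorm_ge0 //.
have sumk : (\sum_i k i ^ 2 <= 4 * c)%N.
  rewrite -(ler_nat R) natr_sum; apply: le_trans suma; apply: ler_sum => i _.
  by rewrite natrX ler_pXn2r ?nnegrE ?ler0n.
have kb i : (k i < (4 * c).+1)%N.
  rewrite ltnS; apply: leq_trans sumk; rewrite (bigD1 i) //=.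
  by apply: leq_trans (leq_addr _ _); case: (k i) => // m; rewrite leq_pmulr.
pose z : net_index := [ffun i => (v i 0 < 0, Ordinal (kb i))].
exists z; first by rewrite inE; under eq_bigr do rewrite ffunE /=.
rewrite hsnorm_cvE.
have D i : `|(v - net_pt z) i 0| <= (2 * Num.sqrt c%:R)^-1.
  rewrite !mxE ffunE /=.
  set b := (v i 0 < 0)%R.
  have -> : v i 0 = (-1) ^+ b * (a i / (2 * Num.sqrt c%:R)).
    have -> : a i / (2 * Num.sqrt c%:R) = `|v i 0|.
      by rewrite /a mulrAC divff ?mul1r // mulf_neq0 // gt_eqF.
    by rewrite -realEsign ?num_real.
  rewrite -mulrA -mulrBr normrM normr_sign mul1r -mulrBl normrM.
  rewrite (ger0_norm (x := _^-1)) ?invr_ge0 ?mulr_ge0 ?sqrtr_ge0 //.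
  rewrite ler_piMl ?invr_ge0 ?mulr_ge0 ?sqrtr_ge0 //.
  have := k_gt i; have := k_le i; rewrite -natr1 ler_norml; lra.
apply: le_trans (l2_le_bound _ D) _; first by rewrite invr_ge0 mulr_ge0 ?sqrtr_ge0.
by rewrite card_ord invfM mulrCA divff ?mulr1 ?gt_eqF.
Qed.

Lemma sum_half_pow n : \sum_(i < n) (2^-1 : R) ^+ i <= 2.
Proof.
suff -> : \sum_(i < n) (2^-1 : R) ^+ i = 2 - 2 * 2^-1 ^+ n.
  by rewrite gerBl mulr_ge0 ?exprn_ge0 ?invr_ge0.
elim: n => [|n IH]; first by rewrite big_ord0 expr0 mulr1 subrr.
by rewrite big_ord_recr /= IH exprS; lra.
Qed.

(** A good [z] has [sum |z_i| <= sum z_i^2 <= 4 c], so the weight [2^(4c) prod 2^(-|z_i|)] is at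
    least 1 on it. Summed over all indices the weight factorizes into [c] sums, each at most 4, and
    [2^4 * 4 = 64]. *)
Lemma net_card : #|net_good|%:R <= 64%:R ^+ c :> R.
Proof.
pose g (x : bool * 'I_(4 * c).+1) : R := 2^-1 ^+ x.2.
have g_ge0 x : 0 <= g x by rewrite exprn_ge0 // invr_ge0.
have step (z : net_index) : z \in net_good -> 1 <= 2 ^+ (4 * c) * \prod_i g (z i).
  rewrite inE => zg; rewrite /g prodrXr.
  rewrite exprVn -ler_pdivrMr ?invr_gt0 ?exprn_gt0 // invrK mul1r.
  rewrite ler_weXn2l ?ler1n //; apply: leq_trans zg; apply: leq_sum => i _.
  by case: (nat_of_ord (z i).2) => // m; rewrite leq_pmulr.
have -> : #|net_good|%:R = \sum_(z in net_good) (1 : R) by rewrite sumr_const.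
apply: le_trans (ler_sum _ step) _.
apply: (@le_trans _ _ (\sum_(z : net_index) (2 ^+ (4 * c) * \prod_i g (z i)))).
  rewrite [leRHS](bigID (mem net_good)) /= lerDl; apply: sumr_ge0 => z _.
  by rewrite mulr_ge0 ?exprn_ge0 // prodr_ge0.
rewrite -mulr_sumr -(bigA_distr_bigA (fun _ : 'I_c => g)) /= prodr_const card_ord.
have sg : \sum_x g x <= 4%:R.
  rewrite -(pair_bigA _ (fun (b : bool) (k : 'I_(4 * c).+1) => g (b, k))) /= big_bool /=.
  have := sum_half_pow (4 * c).+1; rewrite /g /=; lra.
have -> : 64%:R ^+ c = 2 ^+ (4 * c) * 4%:R ^+ c :> R.
  by rewrite exprM -exprMn; congr (_ ^+ c); rewrite -natrX -natrM.
rewrite ler_wpM2l ?exprn_ge0 // lerXn2r ?nnegrE ?sumr_ge0 //.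
Qed.

(* |A v| <= T on the net gives s <= T + s/2 for the operator norm s. *)
Lemma net_opnorm r (A : 'M[R]_(r, c)) (T : R) : (0 < c)%N ->
  (forall z, z \in net_good -> hsnorm (A *m net_pt z) <= T) ->
  forall v : 'cV[R]_c, hsnorm (A *m v) <= 2 * T * hsnorm v.
Proof.
move=> c0 H.
pose E : set R := [set x | exists2 u : 'cV[R]_c, hsnorm u <= 1 & x = hsnorm (A *m u)].
have E0 : E 0 by exists 0; rewrite ?mulmx0 hsnorm0.
have Eub : has_sup E.
  split; first by exists 0.
  exists (hsnorm A) => _ [u u1 ->]; apply: le_trans (hsnorm_mul _ _) _.
  by rewrite ler_piMr ?hsnorm_ge0.
have s0 : 0 <= sup E by apply: (ub_le_sup Eub.2 E0).
have op (u : 'cV[R]_c) : hsnorm (A *m u) <= sup E * hsnorm u.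
  have [u0|un0] := eqVneq (hsnorm u) 0.
    by apply: le_trans (hsnorm_mul _ _) _; rewrite u0 !mulr0.
  have up : 0 < hsnorm u by rewrite lt0r un0 hsnorm_ge0.
  rewrite -ler_pdivrMr //; apply: (ub_le_sup Eub.2).
  exists ((hsnorm u)^-1 *: u).
    by rewrite hsnormZ ger0_norm ?invr_ge0 ?hsnorm_ge0 // mulVf.
  by rewrite -scalemxAr hsnormZ ger0_norm ?invr_ge0 ?hsnorm_ge0 // mulrC.
have sT : sup E <= T + sup E * 2^-1.
  apply: ge_sup; first by exists 0.
  move=> _ [u u1 ->]; have [z zg uz] := net_cover c0 u1.
  rewrite -(subrKC (net_pt z) u) mulmxDr; apply: le_trans (ler_hsnormD _ _) _.
  by apply: lerD; [exact: H | apply: le_trans (op _) _; rewrite ler_wpM2l].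
move=> v; apply: le_trans (op v) _; rewrite ler_wpM2r ?hsnorm_ge0 //.
by move: sT; lra.
Qed.

End Net.

(** * Deterministic size and Lipschitz bounds for the layers *)

Section Network.
Variables (R : realType) (L n : nat) (ns : nat -> nat) (sigma : nat -> R -> R).
Variables (lam tau K : R).
Implicit Types (X : 'M[R]_(ns 0, n)) (W : forall l : nat, 'M[R]_(ns l.+1, ns l)).
Implicit Types (B : forall l : nat, 'cV[R]_(ns l.+1)).

Definition bounded_params X W B : Prop :=
  hsnorm X <= K * Num.sqrt (ns 0 * n)%:R /\
  forall l, (l < L)%N ->
    (forall v : 'cV[R]_(ns l), hsnorm (W l *m v) <= K * Num.sqrt (ns l.+1)%:R * hsnorm v) /\
    hsnorm (B l) <= K * Num.sqrt (ns l.+1)%:R.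

Hypotheses (lam_gt0 : 0 < lam) (tau_ge0 : 0 <= tau) (K_ge1 : 1 <= K).
Hypothesis ns_gt0 : forall l, (l <= L)%N -> (0 < ns l)%N.
Hypothesis sigma_lip : forall l, (l < L)%N ->
  (forall x y, `|sigma l x - sigma l y| <= lam * `|x - y|) /\ `|sigma l 0| <= tau.

Let a : R := 1 + lam + tau.

Lemma sqrt_natM p q : Num.sqrt (p * q)%:R = Num.sqrt p%:R * Num.sqrt q%:R :> R.
Proof. by rewrite natrM sqrtrM ?ler0n. Qed.

Lemma hsnorm_mul_ones p (b : 'cV[R]_p) :
  hsnorm (b *m (const_mx 1 : 'rV[R]_n)) <= hsnorm b * Num.sqrt n%:R.
Proof. by apply: le_trans (hsnorm_mul _ _) _; rewrite hsnorm_const mul1n normr1 mulr1. Qed.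

(** In each layer the factor [sqrt n_(l+1)] from the operator norm cancels the normalization,
    leaving a factor of order [K]. The contributions of the bias and of [sigma l 0] are absorbed
    because the bound of the previous layer is at least [sqrt n]; this is where [2 * a] comes
    from. *)
Lemma hsnorm_Zl_le X W B l : bounded_params X W B -> (l <= L)%N ->
  hsnorm (Zl sigma X W B l) <= (2 * a) ^+ l * K ^+ l.+1 * Num.sqrt n%:R.
Proof.
move=> [bX bWB]; have K0 : 0 <= K by apply: le_trans K_ge1.
have l0 := ltW lam_gt0.
have a1 : 1 <= a by rewrite /a -addrA lerDl addr_ge0.
elim: l => [|l IH] lL.
  have s0 := sqrt_nat_gt0 R (ns_gt0 lL).
  rewrite /= hsnormZ ger0_norm ?invr_ge0 ?sqrtr_ge0 // mulrC ler_pdivrMr //.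
  by apply: le_trans bX _; rewrite sqrt_natM expr0 expr1 mul1r; lra.
have [bW bB] := bWB _ lL; have [sl sl0] := sigma_lip lL.
have s0 := sqrt_nat_gt0 R (ns_gt0 lL).
have {}IH := IH (ltnW lL).
rewrite /= hsnormZ ger0_norm ?invr_ge0 ?sqrtr_ge0 // mulrC ler_pdivrMr //.
apply: le_trans (hsnorm_map_le _ l0 sl sl0) _.
set s := Num.sqrt (ns l.+1)%:R in s0 bW bB *; set r := Num.sqrt n%:R in IH *.
have r0 : 0 <= r by apply: sqrtr_ge0.
set H := (2 * a) ^+ l * K ^+ l.+1 in IH.
have H1 : 1 <= H by rewrite mulr_ege1 // exprn_ege1 //; lra.
have hWZ : hsnorm (W l *m Zl sigma X W B l + B l *m const_mx 1) <= K * s * (H * r) + K * s * r.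
  apply: le_trans (ler_hsnormD _ _) _; apply: lerD.
    apply: le_trans (hsnorm_mul_op _ _ bW) _; rewrite ?mulr_ge0 ?sqrtr_ge0 //.
    by rewrite ler_wpM2l // mulr_ge0 // ltW.
  by apply: le_trans (hsnorm_mul_ones _) _; rewrite ler_wpM2r.
have -> : (2 * a) ^+ l.+1 * K ^+ l.+2 * r * s = 2 * a * K * (H * r * s).
  by rewrite /H exprS [K ^+ l.+2]exprS; ring.
rewrite sqrt_natM -/s -/r.
apply: (@le_trans _ _ (lam * (K * s * (H * r) + K * s * r) + s * r * tau)).
  by rewrite lerD2r ler_pM2l.
have sr0 : 0 <= r * s by rewrite mulr_ge0 // ltW.
have KH1 : 1 <= K * H by rewrite mulr_ege1.
have KH2 : K <= K * H by rewrite ler_peMr.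
rewrite (_ : lam * _ + _ = (lam * (K * H + K) + tau) * (r * s)); last by ring.
rewrite (_ : 2 * a * K * _ = (2 * a * (K * H)) * (r * s)); last by ring.
rewrite ler_wpM2r // /a.
have aux (l' t k x : R) : 0 <= l' -> 0 <= t -> k <= x -> 1 <= x ->
    l' * (x + k) + t <= 2 * (1 + l' + t) * x by move=> *; nra.
exact: aux.
Qed.

Variable delta : R.
Hypothesis delta_n0 : (Num.sqrt (ns 0)%:R)^-1 <= delta.
Hypothesis delta_n : forall l, (0 < l <= L)%N ->
  Num.sqrt n%:R / Num.sqrt (ns l)%:R <= delta.

(** Every term of the difference carries [delta]: perturbing [X] gains [1 / sqrt n_0], while
    perturbing [W l] or [B l] is multiplied by a quantity of order [sqrt n] and divided by
    [sqrt n_(l+1)]. *)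
Lemma hsnorm_Zl_lip X W B X' W' B' (D : R) l :
  bounded_params X W B -> bounded_params X' W' B' ->
  hsnorm (X - X') <= D ->
  (forall l, (l < L)%N -> hsnorm (W l - W' l) <= D /\ hsnorm (B l - B' l) <= D) ->
  (l <= L)%N ->
  hsnorm (Zl sigma X W B l - Zl sigma X' W' B' l) <= (4 * a) ^+ l * K ^+ l * (delta * D).
Proof.
move=> bp bp' hX hWB; have [bX bWB] := bp; have K0 : 0 <= K by apply: le_trans K_ge1.
have l0 := ltW lam_gt0.
have a1 : 1 <= a by rewrite /a -addrA lerDl addr_ge0.
have D0 : 0 <= D by apply: le_trans hX; apply: hsnorm_ge0.
have dl0 : 0 <= delta by apply: le_trans delta_n0; rewrite invr_ge0 sqrtr_ge0.
elim: l => [|l IH] lL.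
  have s0 := sqrt_nat_gt0 R (ns_gt0 lL).
  rewrite /= -scalerBr hsnormZ ger0_norm ?invr_ge0 ?sqrtr_ge0 // !expr0 !mul1r.
  by apply: ler_pM => //; rewrite ?invr_ge0 ?sqrtr_ge0 ?hsnorm_ge0.
have [bW bB] := bWB _ lL; have [sl sl0] := sigma_lip lL.
have [hW hB] := hWB _ lL.
have s0 := sqrt_nat_gt0 R (ns_gt0 lL).
have {}IH := IH (ltnW lL).
have dn := delta_n (l := l.+1) lL.
have HZ := hsnorm_Zl_le bp' (ltnW lL).
rewrite /= -scalerBr hsnormZ ger0_norm ?invr_ge0 ?sqrtr_ge0 // mulrC ler_pdivrMr //.
apply: le_trans (hsnorm_map_lip _ _ l0 sl) _.
set Z := Zl sigma X W B l in IH *; set Z' := Zl sigma X' W' B' l in IH HZ *.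
(* In this telescoping the first term uses the operator bound on [W l] and the induction hypothesis;
   the second uses the Hilbert-Schmidt norm of [W l - W' l] and the size of [Z']. *)
have -> : W l *m Z + B l *m const_mx 1 - (W' l *m Z' + B' l *m const_mx 1) =
  W l *m (Z - Z') + (W l - W' l) *m Z' + (B l - B' l) *m const_mx 1.
  by rewrite opprD addrACA mulmxBr !mulmxBl; congr (_ + _); rewrite addrA subrK.
set s := Num.sqrt (ns l.+1)%:R in s0 bW bB dn *; set r := Num.sqrt n%:R in HZ dn.
have r0 : 0 <= r by apply: sqrtr_ge0.
rewrite ler_pdivrMr // in dn.
set H := (2 * a) ^+ l * K ^+ l.+1 in HZ; set G := (4 * a) ^+ l * K ^+ l in IH.
have H0 : 0 <= H by rewrite mulr_ge0 ?exprn_ge0 //; lra.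
have H1 : 1 <= H by rewrite mulr_ege1 // exprn_ege1 //; lra.
have HG : H <= G * K.
  by rewrite /H /G exprSr mulrA ler_wpM2r // ler_wpM2r ?exprn_ge0 // lerXn2r ?nnegrE //; lra.
apply: (@le_trans _ _ (lam * (K * s * (G * (delta * D)) + D * (H * r) + D * r))).
  rewrite ler_pM2l //; apply: le_trans (ler_hsnormD _ _) _; apply: lerD; last first.
    by apply: le_trans (hsnorm_mul_ones _) _; rewrite ler_wpM2r.
  apply: le_trans (ler_hsnormD _ _) _; apply: lerD.
    apply: le_trans (hsnorm_mul_op _ _ bW) _; rewrite ?mulr_ge0 ?sqrtr_ge0 //.
    by rewrite ler_wpM2l // mulr_ge0 // ltW.
  by apply: le_trans (hsnorm_mul _ _) _; apply: ler_pM; rewrite ?hsnorm_ge0.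
have -> : (4 * a) ^+ l.+1 * K ^+ l.+1 * (delta * D) * s = 4 * a * (G * K) * (delta * s * D).
  by rewrite /G !exprS; ring.
set ds := delta * s in dn *.
have ds0 : 0 <= ds by rewrite mulr_ge0 // ltW.
have t1 : D * (H * r) <= D * (G * K * ds).
  by rewrite ler_wpM2l //; apply: ler_pM.
have t2 : D * r <= D * (G * K * ds).
  rewrite ler_wpM2l // -[leLHS]mul1r; apply: ler_pM => //.
  exact: le_trans H1 HG.
have -> : K * s * (G * (delta * D)) = D * (G * K * ds) by rewrite /ds; ring.
set Q := D * (G * K * ds) in t1 t2 *.
have Q0 : 0 <= Q by rewrite mulr_ge0 // mulr_ge0 //; apply: le_trans HG.
have -> : 4 * a * (G * K) * (ds * D) = 4 * a * Q by rewrite /Q; ring.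
(* Each of the three terms is at most [Q], so the layer contributes [3 * lam * Q], which [4 * a * Q]
   dominates. *)
have la : lam <= a by rewrite /a -addrA addrCA lerDl addr_ge0.
apply: (@le_trans _ _ (lam * (3 * Q))); first by rewrite ler_pM2l //; lra.
have := ler_wpM2r Q0 la; have := ler_wpM2r Q0 (le_trans ler01 a1); lra.
Qed.

End Network.

(** Needed because [Zl] takes families indexed by all naturals, whereas [Params] records only the
    layers below [L]. *)
Lemma eq_Zl (R : realType) n (ns : nat -> nat) (sigma : nat -> R -> R)
  (X : 'M[R]_(ns 0, n)) (W W' : forall l : nat, 'M[R]_(ns l.+1, ns l))
  (B B' : forall l : nat, 'cV[R]_(ns l.+1)) l :
  (forall k, (k < l)%N -> W k = W' k /\ B k = B' k) ->
  Zl sigma X W B l = Zl sigma X W' B' l.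
Proof.
elim: l => [//|l IH] H /=; have [-> ->] := H l (ltnSn l).
by rewrite IH // => k kl; apply: H; rewrite ltnS ltnW.
Qed.

(** * Identification of the parameter space with a Euclidean space *)

Section ParamCoordinates.
Variables (R : realType) (L n : nat) (ns : nat -> nat).

Definition param_index : finType :=
  (('I_(ns 0) * 'I_n) + {l : 'I_L & (('I_(ns l.+1) * 'I_(ns l)) + 'I_(ns l.+1))%type})%type.

Definition param_coord (p : Params R L n ns) (i : param_index) : R :=
  match i with
  | inl ij => p.1 ij.1 ij.2
  | inr (existT l (inl ij)) => (p.2 l).1 ij.1 ij.2
  | inr (existT l (inr i)) => (p.2 l).2 i 0
  end.

Definition param_of_coord (f : param_index -> R) : Params R L n ns :=
  (\matrix_(i, j) f (inl (i, j)),
   fun l => (\matrix_(i, j) f (inr (Tagged _ (inl (i, j)))),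
             \col_i f (inr (Tagged _ (inr i))))).

Lemma param_of_coordK f : param_coord (param_of_coord f) =1 f.
Proof.
by case=> [[i j]|[l [[i j]|i]]]; rewrite /= mxE.
Qed.

Lemma params_distE (p q : Params R L n ns) :
  params_dist p q = l2 (fun i => param_coord p i - param_coord q i).
Proof.
rewrite /params_dist /l2; congr Num.sqrt.
rewrite big_sumType /=; congr (_ + _).
  by rewrite /hs2 pair_big; apply: eq_bigr => ij _; rewrite !mxE.
rewrite (eq_bigr (fun l : 'I_L => \sum_(x : 'I_(ns l.+1) * 'I_(ns l) + 'I_(ns l.+1))
    (param_coord p (inr (Tagged _ x)) - param_coord q (inr (Tagged _ x))) ^+ 2)).
  by rewrite sig_big_dep /=; apply: eq_bigr => -[].
move=> l _; rewrite big_sumType /=; congr (_ + _).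
  by rewrite /hs2 pair_big; apply: eq_bigr => ij _; rewrite !mxE.
by rewrite /hs2; apply: eq_bigr => i _; rewrite big_ord1 !mxE.
Qed.

End ParamCoordinates.

(** * Measurability of Lipschitz functions of random vectors *)

Section RealMeasurability.
Context d (Omega : measurableType d) (R : realType).
Implicit Types f : Omega -> R.

Lemma measurable_ge f c : measurable_fun setT f -> measurable [set w | c <= f w].
Proof.
move=> mf; have := mf measurableT _ (measurable_itv `[c, +oo[).
by rewrite setTI; congr measurable; apply/seteqP; split=> w; rewrite /= in_itv /= andbT.
Qed.

Lemma measurable_le f c : measurable_fun setT f -> measurable [set w | f w <= c].
Proof.
move=> mf; have := mf measurableT _ (measurable_itv `]-oo, c]).
by rewrite setTI; congr measurable; apply/seteqP; split=> w; rewrite /= in_itv.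
Qed.

Lemma measurable_lt f c : measurable_fun setT f -> measurable [set w | f w < c].
Proof.
move=> mf; have := mf measurableT _ (measurable_itv `]-oo, c[).
by rewrite setTI; congr measurable; apply/seteqP; split=> w; rewrite /= in_itv.
Qed.

Lemma measurable_fun_ltP f : (forall c, measurable [set w | f w < c]) -> measurable_fun setT f.
Proof.
move=> H mD; apply: (measurability _ (RGenInftyO.measurableE R)) => //.
move=> _ [_ [c ->] <-]; rewrite setTI.
by have := H c; congr measurable; apply/seteqP; split=> w; rewrite /= in_itv.
Qed.

Lemma measurable_l2 (I : finType) (f : I -> Omega -> R) :
  (forall i, measurable_fun setT (f i)) -> measurable_fun setT (fun w => l2 (f^~ w)).
Proof.
move=> mf; apply: (measurableT_comp (f := @Num.sqrt R)).
  by apply: continuous_measurable_fun; exact: sqrt_continuous.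
by apply: measurable_sum => i; exact: measurable_funX.
Qed.

End RealMeasurability.

(* [F (Y w)] is the infimum of [F q + dist (Y w) q] over the countably many
   points [q] with rational coordinates. *)
Lemma measurable_lipschitz d (Omega : measurableType d) (R : realType) (T : Type) (I : finType)
  (coord : T -> I -> R) (of_coord : (I -> R) -> T) (Y : Omega -> T) (F : T -> R) :
  (forall f, coord (of_coord f) =1 f) ->
  (forall i, measurable_fun setT (fun w => coord (Y w) i)) ->
  (forall p q, `|F p - F q| <= l2 (fun i => coord p i - coord q i)) ->
  measurable_fun setT (fun w => F (Y w)).
Proof.
move=> coordK mY lipF; apply: measurable_fun_ltP => c.
pose q (r : {ffun I -> rat}) : T := of_coord (fun i => ratr (r i)).
pose A r := [set w | l2 (fun i => coord (Y w) i - coord (q r) i) < c - F (q r)].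
rewrite (_ : [set w | _] = \bigcup_r A r).
  apply: countable_bigcupT_measurable; first exact: countableP.
  move=> r; apply: measurable_lt; apply: measurable_l2 => i.
  by apply: measurable_funB => //; exact: mY.
apply/seteqP; split=> w; rewrite /A /=; last first.
  move=> [r _ /=]; have := lipF (Y w) (q r); rewrite ler_norml => /andP[_]; lra.
(* The distance to the rational point is paid twice, once in [F (q r)] and once in the distance
   itself, hence the division by 2. The added 1 makes the inequality strict and the denominator
   positive. *)
move=> Fc; pose e := (c - F (Y w)) / 2 / (Num.sqrt #|I|%:R + 1).
have sI : 0 <= Num.sqrt #|I|%:R :> R by apply: sqrtr_ge0.
have e0 : 0 < e by rewrite !divr_gt0 ?subr_gt0 // ltr_wpDl.
have Hq i : {r : rat | `|coord (Y w) i - ratr r| <= e}.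
  apply: cid; have [|r] := @rat_in_itvoo R (coord (Y w) i - e) (coord (Y w) i + e).
    by lra.
  rewrite in_itv /= => /andP[h1 h2]; exists r; rewrite ler_norml; lra.
pose r : {ffun I -> rat} := [ffun i => sval (Hq i)].
exists r => //=.
have dY : l2 (fun i => coord (Y w) i - coord (q r) i) <= Num.sqrt #|I|%:R * e.
  apply: l2_le_bound; first exact: ltW.
  by move=> i; rewrite /q coordK /r ffunE; exact: (svalP (Hq i)).
have : (Num.sqrt #|I|%:R + 1) * e = (c - F (Y w)) / 2.
  by rewrite /e mulrC divfK // gt_eqF // ltr_wpDl.
have := lipF (Y w) (q r); rewrite ler_norml => /andP[+ _]; rewrite mulrDl; lra.
Qed.

(** * Medians, union bounds and second moments *)

Section Probability.
Context d (Omega : measurableType d) (R : realType) (P : probability Omega R).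
Implicit Types (f g : Omega -> R) (A B : set Omega).

Lemma le_prob A B : measurable A -> measurable B -> A `<=` B -> (P A <= P B)%E.
Proof. by move=> mA mB AB; apply: le_measure => //; rewrite inE. Qed.

(** The median is the infimum of the points where the distribution function is at least 1/2: right
    continuity gives one inequality, continuity of [P] from below the other. Existence matters
    because [subgauss_conc] says something about a function only once a median of it is given. *)
Lemma median_exists f : measurable_fun setT f -> exists m, is_median P f m.
Proof.
move=> mf; pose X : {RV P >-> R} := mfun_Sub (mem_set mf).
have cdfE r : cdf X r = P [set w | f w <= r].
  rewrite /cdf /distribution /pushforward; congr (P _).
pose h : \bar R := (1 / 2)%:E.
pose S := [set r | (h <= cdf X r)%E].
have S0 : S !=set0.
  have := @cvg_cdfy1 _ _ _ _ X => /(_ [set x | (h < x)%E]) /=.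
  have nb : nbhs (1%E : \bar R) [set x | (h < x)%E].
    by apply: open_nbhs_nbhs; split; [exact: open_ereal_gt_ereal | rewrite /h /= lte_fin; lra].
  move=> /(_ nb) [M [_ HM]]; exists (M + 1); apply: ltW; apply: HM; lra.
have Slb : has_lbound S.
  have := @cvg_cdfNy0 _ _ _ _ X => /(_ [set x | (x < h)%E]) /=.
  have nb : nbhs (0%E : \bar R) [set x | (x < h)%E].
    by apply: open_nbhs_nbhs; split; [exact: open_ereal_lt_ereal | rewrite /h /= lte_fin; lra].
  move=> /(_ nb) [M [_ HM]]; exists (M - 1) => r Sr; rewrite leNgt; apply/negP => rM.
  have /HM /= : r < M by lra.
  by rewrite ltNge (Sr : (h <= cdf X r)%E).
exists (inf S); split.
  have cr := @cdf_right_continuous _ _ _ _ X (inf S).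
  rewrite -cdfE; apply: (cvge_ge _ cr).
  near=> x; have xm : inf S < x by near: x; exact: nbhs_right_gt.
  have [s Ss sx] := inf_lt S0 xm.
  by apply: le_trans Ss _; apply: cdf_nondecreasing; exact: ltW.
(* These sets increase to [f < inf S], and each has probability below 1/2 by minimality of
   [inf S]. *)
pose A n := [set w | f w <= inf S - n.+1%:R^-1].
have mA n : measurable (A n) by exact: measurable_le.
have UA : \bigcup_n A n = [set w | f w < inf S].
  apply/seteqP; split=> w; rewrite /A /=.
    by move=> [n _ /=] fn; apply: le_lt_trans fn _; rewrite gtrBl invr_gt0 ltr0n.
  move=> fw; have e0 : 0 < inf S - f w by rewrite subr_gt0.
  exists (Num.truncn (inf S - f w)^-1) => //=.
  have : (Num.truncn (inf S - f w)^-1).+1%:R^-1 < inf S - f w.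
    by rewrite invf_plt ?posrE ?ltr0n // truncnS_gt.
  by move=> h1; rewrite lerBrDr -lerBrDl ltW.
have PA : (P [set w | (f w < inf S)%R] <= h)%E.
  have cv : P \o A @ \oo --> P (\bigcup_n A n).
    apply: nondecreasing_cvg_mu => //; first exact: bigcup_measurable.
    move=> m n mn; apply/subsetPset => w; rewrite /A /= => /le_trans; apply.
    by rewrite lerD2l lerN2 lef_pV2 ?posrE ?ltr0n // ler_nat.
  rewrite -UA; apply: (cvge_to_le cv); apply: nearW => n /=.
  rewrite leNgt; apply/negP => /ltW; rewrite /A -cdfE => Sn.
  by have := ge_inf Slb Sn; rewrite lerBrDr gerDl invr_le0 leNgt ltr0n.
rewrite (_ : [set w | _] = ~` [set w | f w < inf S]); last first.
  by apply/seteqP; split=> w /=; rewrite leNgt => /negP.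
rewrite probability_setC; last exact: measurable_lt.
move: PA; rewrite /h; have := fin_num_measure P _ (measurable_lt (inf S) mf).
case: (P [set w | f w < inf S]) => // x _; rewrite -EFinB !lee_fin; lra.
Unshelve. all: by end_near.
Qed.

Lemma integral_prob_cst (r : R) : (\int[P]_w r%:E = r%:E)%E.
Proof.
rewrite integral_cst // -[RHS]mule1; congr (_ * _)%E; exact: probability_setT.
Qed.

Lemma prob_bigsetU_le (J : Type) (s : seq J) (Q : pred J) (A : J -> set Omega) (b : J -> R) :
  (forall j, measurable (A j)) -> (forall j, Q j -> (P (A j) <= (b j)%:E)%E) ->
  (P (\big[setU/set0]_(j <- s | Q j) A j) <= (\sum_(j <- s | Q j) b j)%:E)%E.
Proof.
move=> mA bA; elim: s => [|j s IH]; first by rewrite !big_nil measure0.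
rewrite !big_cons; case: ifPn => // Qj.
apply: le_trans (measureU2 _ _ _) _ => //; first exact: bigsetU_measurable.
by rewrite EFinD; apply: leeD => //; exact: bA.
Qed.

Lemma markov_sqr f (c : R) : measurable_fun setT f -> 0 < c ->
  ((c ^+ 2)%:E * P [set w | (c <= f w)%R] <= \int[P]_w (f w ^+ 2)%:E)%E.
Proof.
move=> mf c0; have mc := measurable_ge c mf.
rewrite -[[set w | _]](setIT) -integral_indic // -ge0_integralZl_EFin //; last 2 first.
- by apply/measurable_EFinP; exact: measurable_indic.
- exact: sqr_ge0.
apply: ge0_le_integral => //.
- by move=> w _; rewrite mule_ge0 ?lee_fin ?sqr_ge0.
- apply: emeasurable_funM => //; apply/measurable_EFinP; exact: measurable_indic.
- by apply/measurable_EFinP; exact: measurable_funX.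
move=> w _; rewrite -EFinM lee_fin indicE; case: (boolP (w \in _)) => [|_].
  by rewrite inE /= => cf; rewrite mulr1 lerXn2r ?nnegrE ?(ltW c0) // (le_trans (ltW c0)).
by rewrite mulr0 sqr_ge0.
Qed.

Lemma expRN_le_sqrV (y : R) : 0 < y -> expR (- y) <= 4 / y ^+ 2.
Proof.
move=> y0; rewrite expRN -invf_div lef_pV2 ?posrE ?expR_gt0 ?divr_gt0 ?exprn_gt0 //.
have -> : expR y = expR (y / 2) ^+ 2 by rewrite -expRM_natl; congr expR; lra.
have -> : y ^+ 2 / 4 = (y / 2) ^+ 2 by field.
rewrite lerXn2r ?nnegrE ?expR_ge0 //; first lra.
by apply: le_trans (expR_ge1Dx _); lra.
Qed.

Lemma dyadic_bracket (x : R) : 1 <= x -> exists k, 2 ^+ k <= x < 2 ^+ k.+1.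
Proof.
move=> x1; have ex : exists k, x < 2 ^+ k.+1.
  exists (Num.truncn x); apply: lt_le_trans (truncnS_gt x) _.
  by rewrite -natrX ler_nat ltnW // ltn_expl.
exists (ex_minn ex); case: ex_minnP => k xk kmin; rewrite xk andbT.
case: k xk kmin => [//|k] _ kmin; rewrite leNgt; apply/negP => /kmin.
by rewrite ltnn.
Qed.

(** A dyadic decomposition replaces the layer-cake integral: [g^2] is at most [rho^2] plus the sum
    of [rho^2 4^(k+1)] over the levels with [rho 2^k <= |g|]. *)
Lemma subgaussian_second_moment g (rho : R) : 0 < rho -> measurable_fun setT g ->
  (forall t, 0 < t -> (P [set w | (t <= `|g w|)%R] <= (2 * expR (- (t ^+ 2 / rho ^+ 2)))%:E)%E) ->
  (\int[P]_w (g w ^+ 2)%:E <= (65 * rho ^+ 2)%:E)%E.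
Proof.
move=> rho0 mg tail.
pose A k := [set w | rho * 2 ^+ k <= `|g w|].
have mag : measurable_fun setT (fun w => `|g w|) by exact: measurableT_comp.
have mA k : measurable (A k) by exact: measurable_ge.
pose f k w : \bar R := ((rho ^+ 2 * 4 ^+ k.+1)%:E * (\1_(A k) w)%:E)%E.
have f0 k w : (0 <= f k w)%E.
  by rewrite mule_ge0 // lee_fin mulr_ge0 ?sqr_ge0 ?exprn_ge0.
have mf k : measurable_fun setT (f k).
  by apply: emeasurable_funM => //; apply/measurable_EFinP; exact: measurable_indic.
have step : (\int[P]_w (g w ^+ 2)%:E <= \int[P]_w ((rho ^+ 2)%:E + \sum_(k <oo) f k w))%E.
  apply: ge0_le_integral => //.
  - by move=> w _; rewrite lee_fin sqr_ge0.
  - by apply/measurable_EFinP; exact: measurable_funX.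
  - by apply: emeasurable_funD => //; apply: ge0_emeasurable_sum.
  move=> w _; have [gr|gr] := leP rho `|g w|.
    have x1 : 1 <= `|g w| / rho by rewrite ler_pdivlMr // mul1r.
    have [k /andP[k1 k2]] := dyadic_bracket x1.
    rewrite ler_pdivlMr // mulrC in k1; rewrite ltr_pdivrMr // in k2.
    apply: (@le_trans _ _ (f k w)).
      rewrite /f indicE mem_set // mule1 lee_fin -real_normK ?num_real //.
      have -> : rho ^+ 2 * 4 ^+ k.+1 = (2 ^+ k.+1 * rho) ^+ 2.
        by rewrite exprMn -exprM mulnC exprM mulrC; congr (_ ^+ _ * _); ring.
      by rewrite lerXn2r ?nnegrE ?mulr_ge0 ?exprn_ge0 // ltW.
    apply: (@le_trans _ _ (\sum_(j <oo) f j w)%E); last by rewrite leeDr // lee_fin sqr_ge0.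
    apply: le_trans (nneseries_lim_ge k.+1 _) => //.
    by rewrite big_mkord big_ord_recr /= leeDr // sume_ge0.
  apply: le_trans (leeDl _ _); last by apply: nneseries_ge0 => *; exact: f0.
  by rewrite lee_fin -real_normK ?num_real // lerXn2r ?nnegrE // ltW.
apply: le_trans step _.
rewrite ge0_integralD //; last 3 first.
- by move=> w _; rewrite lee_fin sqr_ge0.
- by move=> w _; apply: nneseries_ge0 => *; exact: f0.
- by apply: ge0_emeasurable_sum.
rewrite integral_prob_cst integral_nneseries //.
have -> : 65 * rho ^+ 2 = rho ^+ 2 + 64 * rho ^+ 2 by ring.
rewrite EFinD leeD2l //.
(* The tail at level [k] is at most [2 exp (- 4^k) <= 8 / 4^(2k)], so the integral is at most
   [32 rho^2 4^-k]. Weakening this to [2^-k] gives a total of [64 rho^2]. *)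
have fk k : (\int[P]_w f k w <= (32 * rho ^+ 2 * 2^-1 ^+ k)%:E)%E.
  rewrite ge0_integralZl_EFin //; last 2 first.
  - by apply/measurable_EFinP; exact: measurable_indic.
  - by rewrite mulr_ge0 ?sqr_ge0 ?exprn_ge0.
  rewrite integral_indic // setIT.
  have t0 : 0 < rho * 2 ^+ k by rewrite mulr_gt0 ?exprn_gt0.
  have := tail _ t0; rewrite -/(A k) => H.
  apply: (@le_trans _ _ ((rho ^+ 2 * 4 ^+ k.+1)%:E * (2 * (4 / (4 ^+ k) ^+ 2))%:E)%E).
    rewrite lee_wpmul2l ?lee_fin ?mulr_ge0 ?sqr_ge0 ?exprn_ge0 ?(ltW rho0) //.
    apply: le_trans H _; rewrite lee_fin ler_pM2l //.
    have -> : (rho * 2 ^+ k) ^+ 2 / rho ^+ 2 = 4 ^+ k.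
      rewrite exprMn mulrAC divff ?gt_eqF ?exprn_gt0 // mul1r -exprM mulnC exprM.
      by congr (_ ^+ _); ring.
    by apply: expRN_le_sqrV; rewrite exprn_gt0.
  rewrite -EFinM lee_fin.
  have p4 : 0 < 4 ^+ k :> R by rewrite exprn_gt0.
  have -> : rho ^+ 2 * 4 ^+ k.+1 * (2 * (4 / (4 ^+ k) ^+ 2)) = 32 * rho ^+ 2 * 4^-1 ^+ k.
    by rewrite [4 ^+ k.+1]exprS exprVn; move: (4 ^+ k) p4 => x x0; field; rewrite gt_eqF.
  rewrite ler_wpM2l ?mulr_ge0 ?sqr_ge0 ?(ltW rho0) // lerXn2r ?nnegrE ?invr_ge0 //.
  by rewrite lef_pV2 ?posrE //; lra.
apply: (@lime_le _ _ _ _ _ _ _); first by apply: is_cvg_nneseries => *; exact: integral_ge0.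
apply: nearW => N.
apply: (@le_trans _ _ (\sum_(0 <= k < N) (32 * rho ^+ 2 * 2^-1 ^+ k)%:E)%E).
  by apply: lee_sum => k _; exact: fk.
rewrite sumEFin lee_fin -mulr_sumr big_mkord.
have := sum_half_pow R N; have := sqr_ge0 rho; nra.
Qed.

(** Expanding around [m] gives [E f^2 = E (f - m)^2 - m^2], since [f] has mean zero. This turns
    concentration around a median into a bound on the variance. *)
Lemma centered_second_moment_le f (m b : R) : centered_rv P f ->
  (\int[P]_w ((f w - m) ^+ 2)%:E <= b%:E)%E -> (\int[P]_w (f w ^+ 2)%:E <= b%:E)%E.
Proof.
move=> [fi f0] gb.
have mf : measurable_fun setT f by apply/measurable_EFinP; exact: measurable_int fi.
have mg : measurable_fun setT (fun w => (f w - m) ^+ 2).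
  by apply: measurable_funX; exact: measurable_funB.
have gi : P.-integrable setT (fun w => ((f w - m) ^+ 2)%:E).
  apply/integrableP; split; first exact/measurable_EFinP.
  apply: le_lt_trans (ltry b); apply: le_trans gb.
  apply: ge0_le_integral => //.
  - by apply: measurableT_comp => //; exact/measurable_EFinP.
  - exact/measurable_EFinP.
  - by move=> w _; rewrite gee0_abs ?lee_fin ?sqr_ge0.
have ci (c : R) : P.-integrable setT (fun _ : Omega => c%:E).
  by apply: finite_measure_integrable_cst.
have fmi : P.-integrable setT (fun w => ((2 * m)%:E * (f w)%:E)%E).
  exact: integrableZl.
have -> : (\int[P]_w (f w ^+ 2)%:E = \int[P]_w (((f w - m) ^+ 2)%:E +
    ((2 * m)%:E * (f w)%:E + (- m ^+ 2)%:E)))%E.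
  by apply: eq_integral => w _; rewrite -EFinM -!EFinD; congr EFin; ring.
rewrite integralD //; last by apply: integrableD.
rewrite integralD // integralZl // f0 mule0 add0e integral_prob_cst.
apply: le_trans gb; rewrite -[leRHS]adde0 leeD2l // lee_fin oppr_le0 sqr_ge0 //.
Qed.

End Probability.

(** * Concentration of norms and of locally Lipschitz functions *)

Section Concentration.
Context d (Omega : measurableType d) (R : realType) (P : probability Omega R).
Variables (T : Type) (dist : T -> T -> R) (Y : Omega -> T) (rho : R).
Hypothesis rho_gt0 : 0 < rho.
Hypothesis lip_measurable : forall F : T -> R, (forall p q, `|F p - F q| <= dist p q) ->
  measurable_fun setT (fun w => F (Y w)).
Hypothesis conc : subgauss_conc P dist Y rho.

Lemma lip_second_moment (f : T -> R) : (forall p q, `|f p - f q| <= dist p q) ->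
  centered_rv P (fun w => f (Y w)) ->
  (\int[P]_w (f (Y w) ^+ 2)%:E <= (65 * rho ^+ 2)%:E)%E.
Proof.
move=> lf cf; have mf := lip_measurable lf.
have [m med] := median_exists P mf.
apply: (@centered_second_moment_le _ _ _ _ _ m _ cf).
apply: subgaussian_second_moment => //; first exact: measurable_funB.
by move=> t t0; exact: conc lf _ med _ t0.
Qed.

(* A median [m] of [h = l2 (f Y)] satisfies [m^2 / 2 <= E h^2 <= 65 rho^2 #|I|]. *)
Lemma l2_concentration (I : finType) (f : I -> T -> R) (s : R) :
  (forall p q, l2 (fun i => f i p - f i q) <= dist p q) ->
  (forall i, centered_rv P (fun w => f i (Y w))) -> 0 < s ->
  (P [set w | (12 * rho * Num.sqrt #|I|%:R + s <= l2 (fun i => f i (Y w)))%R]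
     <= (2 * expR (- (s ^+ 2 / rho ^+ 2)))%:E)%E.
Proof.
move=> lf cf s0.
pose h p := l2 (fun i => f i p).
have lh p q : `|h p - h q| <= dist p q by apply: le_trans (ler_l2B _ _) (lf p q).
have lfi i p q : `|f i p - f i q| <= dist p q.
  by apply: le_trans (lf p q); exact: (normr_le_l2 (fun i => f i p - f i q)).
have mh := lip_measurable lh.
have [m med] := median_exists P mh.
(* The constant 12 works because [m^2 <= 130 rho^2 #|I|] and [130 <= 144]. *)
have hm : m <= 12 * rho * Num.sqrt #|I|%:R.
  have [m0|m0] := leP m 0.
    by apply: le_trans m0 _; rewrite !mulr_ge0 ?sqrtr_ge0 // ltW.
  have M1 := markov_sqr P mh m0.
  have M2 : (\int[P]_w (h (Y w) ^+ 2)%:E <= (65 * rho ^+ 2 * #|I|%:R)%:E)%E.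
    under eq_integral do rewrite sqr_l2 -sumEFin.
    rewrite ge0_integral_sum //; last 2 first.
    - by move=> i; apply/measurable_EFinP; apply: measurable_funX; exact: lip_measurable (lfi i).
    - by move=> i w _; rewrite lee_fin sqr_ge0.
    apply: (@le_trans _ _ (\sum_(i : I) (65 * rho ^+ 2)%:E)%E).
      by apply: lee_sum => i _; exact: lip_second_moment (lfi i) (cf i).
    by rewrite sumEFin lee_fin sumr_const mulr_natr.
  have M3 : m ^+ 2 * (1 / 2) <= 65 * rho ^+ 2 * #|I|%:R.
    rewrite -lee_fin EFinM; apply: le_trans M2; apply: le_trans M1.
    by rewrite lee_wpmul2l ?lee_fin ?sqr_ge0 //; exact: med.2.
  rewrite -(@ler_pXn2r _ 2) ?nnegrE ?mulr_ge0 ?sqrtr_ge0 ?(ltW rho_gt0) ?(ltW m0) //.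
  rewrite !exprMn sqr_sqrt_nat.
  have : 0 <= rho ^+ 2 * #|I|%:R by rewrite mulr_ge0 ?sqr_ge0.
  by move: M3; rewrite -!mulrA; lra.
apply: le_trans (conc lh med s0); apply: le_prob.
- exact: (measurable_ge _ mh).
- apply: measurable_ge; apply: measurableT_comp => //; exact: measurable_funB.
move=> w /=; rewrite -/(h (Y w)) => hw; rewrite ger0_norm; lra.
Qed.

Lemma lipschitz_concentration (F : T -> R) (k m t : R) : 0 < k ->
  (forall p q, `|F p - F q| <= k * dist p q) ->
  is_median P (fun w => F (Y w)) m -> 0 < t ->
  (P [set w | (t <= `|F (Y w) - m|)%R] <= (2 * expR (- ((t / k) ^+ 2 / rho ^+ 2)))%:E)%E.
Proof.
move=> k0 lF [m1 m2] t0.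
have lk p q : `|k^-1 * F p - k^-1 * F q| <= dist p q.
  by rewrite -mulrBr normrM gtr0_norm ?invr_gt0 // mulrC ler_pdivrMr // mulrC.
have med : is_median P (fun w => k^-1 * F (Y w)) (k^-1 * m).
  split.
    by under eq_set do rewrite ler_pM2l ?invr_gt0 //.
  by under eq_set do rewrite ler_pM2l ?invr_gt0 //.
have := conc lk med (divr_gt0 t0 k0).
congr (P _ <= _)%E; apply/seteqP; split=> w /=.
  by rewrite -mulrBr normrM gtr0_norm ?invr_gt0 // mulrC ler_pM2l ?invr_gt0.
by rewrite -mulrBr normrM gtr0_norm ?invr_gt0 // mulrC ler_pM2l ?invr_gt0.
Qed.

Lemma lipschitz_measurable (F : T -> R) (k : R) : 0 < k ->
  (forall p q, `|F p - F q| <= k * dist p q) -> measurable_fun setT (fun w => F (Y w)).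
Proof.
move=> k0 lF.
have lk p q : `|k^-1 * F p - k^-1 * F q| <= dist p q.
  by rewrite -mulrBr normrM gtr0_norm ?invr_gt0 // mulrC ler_pdivrMr // mulrC.
rewrite (_ : (fun w => _) = (fun w => k * (k^-1 * F (Y w)))).
  by apply: measurable_funM => //; exact: lip_measurable lk.
by apply/funext => w; rewrite mulVKf // gt_eqF.
Qed.

Hypothesis dist_triangle : forall p q r, dist p r <= dist p q + dist q r.
Hypothesis dist_sym : forall p q, dist p q = dist q p.
Hypothesis dist_refl : forall p, dist p p = 0.

(** McShane's infimum formula; comparison with the base point [g0] bounds the infimum from below. *)
Lemma lipschitz_extension (G : set T) (F : T -> R) (k : R) : 0 < k -> G !=set0 ->
  (forall p q, G p -> G q -> `|F p - F q| <= k * dist p q) ->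
  exists2 F' : T -> R, (forall p q, `|F' p - F' q| <= k * dist p q) & {in G, F =1 F'}.
Proof.
move=> k0 [g0 Gg0] lF.
pose E p := [set F q + k * dist p q | q in G].
have E0 p : E p !=set0 by exists (F g0 + k * dist p g0), g0.
have Elb p : lbound (E p) (F g0 - k * dist p g0).
  move=> _ [q Gq <-]; have := lF _ _ Gg0 Gq; rewrite ler_norml => /andP[_].
  have := dist_triangle g0 p q; rewrite (dist_sym g0 p) -(ler_pM2l k0) mulrDr; lra.
have Ehlb p : has_lbound (E p) by exists (F g0 - k * dist p g0).
pose F' p := inf (E p).
have half p q : F' p - F' q <= k * dist p q.
  rewrite lerBlDr addrC -lerBlDr; apply: lb_le_inf => //.
  move=> _ [r Gr <-]; rewrite lerBlDr.
  apply: (@le_trans _ _ (F r + k * dist p r)); first by apply: (ge_inf (Ehlb p)); exists r.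
  by rewrite -addrA lerD2l -mulrDr ler_pM2l // addrC dist_triangle.
exists F'.
  by move=> p q; rewrite ler_norml half lerNl opprB dist_sym half.
move=> p; rewrite inE => Gp; apply/eqP; rewrite eq_le; apply/andP; split.
  apply: lb_le_inf => // _ [q Gq <-]; have := lF _ _ Gp Gq; rewrite ler_norml => /andP[_]; lra.
by apply: (ge_inf (Ehlb p)); exists p => //; rewrite dist_refl mulr0 addr0.
Qed.

(* Once the two error probabilities add up to less than 1/2, the medians of [F]
   and of its Lipschitz extension are within [t / 2]. *)
Lemma local_lipschitz_concentration (G : set T) (Bad : set Omega) (F : T -> R)
  (k m t b : R) : 0 < k -> G !=set0 ->
  (forall p q, G p -> G q -> `|F p - F q| <= k * dist p q) ->
  measurable_fun setT (fun w => F (Y w)) ->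
  measurable Bad -> (forall w, ~ Bad w -> G (Y w)) -> (P Bad <= b%:E)%E ->
  b + 2 * expR (- ((t / 2 / k) ^+ 2 / rho ^+ 2)) < 1 / 2 ->
  is_median P (fun w => F (Y w)) m -> 0 < t ->
  (P [set w | (t <= `|F (Y w) - m|)%R] <=
    (b + 2 * expR (- ((t / 2 / k) ^+ 2 / rho ^+ 2)))%:E)%E.
Proof.
move=> k0 G0 lF mF mBad BadG Pb small [m1 m2] t0.
have [F' lF' FF'] := lipschitz_extension k0 G0 lF.
have mF' := lipschitz_measurable k0 lF'.
have [m' med'] := median_exists P mF'.
have t20 : 0 < t / 2 by rewrite divr_gt0.
have conc' := lipschitz_concentration k0 lF' med' t20.
set Dev := [set w | t / 2 <= `|F' (Y w) - m'|] in conc'.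
have mDev : measurable Dev.
  by apply: measurable_ge; apply: measurableT_comp => //; exact: measurable_funB.
have PU : (P (Bad `|` Dev) <= (b + 2 * expR (- ((t / 2 / k) ^+ 2 / rho ^+ 2)))%:E)%E.
  by rewrite EFinD; apply: le_trans (measureU2 _ _ _) _ => //; exact: leeD.
have mU : measurable (Bad `|` Dev) by exact: measurableU.
have PUlt : (P (Bad `|` Dev) < (1 / 2)%:E)%E by apply: le_lt_trans PU _; rewrite lte_fin.
have off w : ~ (Bad `|` Dev) w -> F (Y w) = F' (Y w) /\ `|F' (Y w) - m'| < t / 2.
  move=> nU; split; first by apply: FF'; rewrite inE; apply: BadG => Bw; apply: nU; left.
  by rewrite ltNge; apply/negP => Dw; apply: nU; right.
(* If the medians were at least [t / 2] apart, one of the events [F <= m] and [m <= F], each of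
   probability at least 1/2, would be contained in [Bad] together with [Dev]. *)
have mm : `|m - m'| < t / 2.
  rewrite ltr_norml; apply/andP; split; rewrite ltNge; apply/negP => mm'.
    have : ((1 / 2)%:E <= P (Bad `|` Dev))%E.
      apply: le_trans m1 _; apply: le_prob => //; first exact: measurable_le.
      move=> w /= Fm; apply: contrapT => /off[Fe]; move: Fm; rewrite Fe ltr_norml => ? /andP[]; lra.
    by rewrite leNgt PUlt.
  have : ((1 / 2)%:E <= P (Bad `|` Dev))%E.
    apply: le_trans m2 _; apply: le_prob => //; first exact: measurable_ge.
    move=> w /= Fm; apply: contrapT => /off[Fe]; move: Fm; rewrite Fe ltr_norml => ? /andP[]; lra.
  by rewrite leNgt PUlt.
apply: le_trans PU; apply: le_prob => //.
  by apply: measurable_ge; apply: measurableT_comp => //; exact: measurable_funB.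
move=> w /= Fm; apply: contrapT => /off[Fe]; move: Fm; rewrite Fe.
have := ler_distD m' (F' (Y w)) m; rewrite (distrC m' m); lra.
Qed.

End Concentration.

(** * The rate [minexp] and the absorption of prefactors *)

Lemma minexp_term_expn (R : realType) (n i : nat) (t : R) : 0 < t ->
  (n%:R `^ (i%:R / i.+1%:R) * t `^ (2 / i.+1%:R)) ^+ i.+1 = n%:R ^+ i * t ^+ 2.
Proof.
move=> t0.
have E (x : R) k : 0 <= x -> (x `^ (k%:R / i.+1%:R)) ^+ i.+1 = x ^+ k.
  by move=> x0; rewrite -powR_mulrn ?powR_ge0 // -powRrM divfK ?pnatr_eq0 // powR_mulrn.
by rewrite exprMn !E // ltW.
Qed.

Section Minexp.
Variables (R : realType) (L n : nat) (t : R).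
Hypothesis (t_gt0 : 0 < t).

Lemma minexp_le_sqr : minexp L n t <= t ^+ 2.
Proof. exact: bigmin_le_id. Qed.

Lemma minexp_le_last :
  minexp L n t <= n%:R `^ (L%:R / L.+1%:R) * t `^ (2 / L.+1%:R).
Proof. by apply: (bigmin_le_cond _ (fun i : 'I_L.+1 => _) (j := ord_max)). Qed.

Lemma minexp_ge0 : 0 <= minexp L n t.
Proof.
apply: le_bigmin; first exact: sqr_ge0.
by move=> i _; rewrite mulr_ge0 ?powR_ge0.
Qed.

(** Raising the term of index [i] to the power [i.+1] clears the fractional exponents and leaves
    [n^i t^2], which is compared factor by factor with [(g t^2)^i (g t^2)]. For [L = 0] the only
    term is [t^2], so no bound by [n] is required. *)
Lemma minexp_ge (g : R) : 0 <= g <= 1 -> ((0 < L)%N -> g * t ^+ 2 <= n%:R) ->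
  g * t ^+ 2 <= minexp L n t.
Proof.
move=> /andP[g0 g1] gn; have t2 := sqr_ge0 t.
have gt0 : 0 <= g * t ^+ 2 by exact: mulr_ge0.
apply: le_bigmin => [|i _]; first by rewrite ler_piMl.
rewrite -(@ler_pXn2r _ i.+1) ?nnegrE //; last by rewrite mulr_ge0 ?powR_ge0.
rewrite minexp_term_expn // [(g * _) ^+ _]exprSr; apply: ler_pM => //; first exact: exprn_ge0.
  case: (posnP i) => [->|i0]; first by rewrite !expr0.
  rewrite lerXn2r ?nnegrE ?ler0n //; apply: gn.
  by apply: leq_trans i0 _; rewrite -ltnS.
by rewrite ler_piMl.
Qed.

(* Balances [K^2 n], the exponent of the bad event, against [t^2 / K^(2L)], that of
   the Lipschitz part. *)
Lemma balanced_radius (K0 : R) : (0 < n)%N -> 1 <= K0 ->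
  exists2 K, K0 <= K &
    minexp L n t / K0 ^+ (2 * L) <= K ^+ 2 * n%:R /\
    minexp L n t / K0 ^+ (2 * L) <= t ^+ 2 / K ^+ (2 * L).
Proof.
move=> n0 K1; have n0' : 0 < n%:R :> R by rewrite ltr0n.
have K0p : 0 < K0 by apply: lt_le_trans K1.
have g0 : 0 < K0 ^+ (2 * L) by rewrite exprn_gt0.
have [tn|tn] := leP (t ^+ 2) (K0 ^+ (2 * L.+1) * n%:R).
  exists K0 => //; split; last by rewrite ler_pM2r ?invr_gt0 // minexp_le_sqr.
  rewrite ler_pdivrMr //; apply: le_trans minexp_le_sqr _; apply: le_trans tn _.
  by rewrite mulnS exprD mulrAC.
(* Here [y] is the last term of the minimum. The choice [K^2 = y / n] makes both [K^2 n] and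
   [t^2 / K^(2L)] equal to [y], and [K^(2(L+1)) = t^2 / n] exceeds [K0^(2(L+1))] in this case. *)
set y := n%:R `^ (L%:R / L.+1%:R) * t `^ (2 / L.+1%:R).
have yp : 0 < y by rewrite mulr_gt0 // powR_gt0.
have yE : y ^+ L.+1 = n%:R ^+ L * t ^+ 2 by exact: minexp_term_expn.
have yn0 : 0 <= y / n%:R by rewrite divr_ge0 // ltW.
pose K := Num.sqrt (y / n%:R).
have K2 : K ^+ 2 = y / n%:R by rewrite sqr_sqrtr.
have my : minexp L n t / K0 ^+ (2 * L) <= y.
  rewrite ler_pdivrMr //; apply: le_trans minexp_le_last _.
  by rewrite ler_peMr ?(ltW yp) // exprn_ege1.
have KL : t ^+ 2 / K ^+ (2 * L) = y.
  apply/eqP; rewrite exprM K2 eq_sym -subr_eq0; apply/eqP.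
  have -> : t ^+ 2 = y ^+ L.+1 / n%:R ^+ L by rewrite yE mulrAC divff ?mul1r // expf_neq0 // gt_eqF.
  rewrite expr_div_n exprS; field.
  by rewrite !expf_neq0 // gt_eqF.
exists K; last by rewrite KL K2 divfK ?gt_eqF.
rewrite -(@ler_pXn2r _ (2 * L.+1)%N) ?nnegrE ?sqrtr_ge0 ?(ltW K0p) //.
rewrite [leRHS]exprM K2 expr_div_n yE.
have -> : n%:R ^+ L * t ^+ 2 / n%:R ^+ L.+1 = t ^+ 2 / n%:R.
  by rewrite [_ ^+ L.+1]exprS; field; rewrite expf_neq0 gt_eqF.
by rewrite ler_pdivlMr // ltW.
Qed.

End Minexp.

(* If [expR (- (x / k)) >= 1 / 2] the claim follows from [p <= 1]; otherwise [k - 1] of the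
   [k] factors of [expR (- x)] absorb [A]. *)
Lemma absorb_prefactor (R : realType) (p : \bar R) (q A x : R) (k : nat) :
  (p <= 1)%E -> (q < 1 / 2 -> (p <= q%:E)%E) -> q <= A * expR (- x) -> 2 * A <= 2 ^+ k ->
  (0 < k)%N -> (p <= (2 * expR (- (x / k%:R)))%:E)%E.
Proof.
move=> p1 pq qA Ak k0.
have [y [<- y0 yk]] : exists y, [/\ y = expR (- (x / k%:R)), 0 < y & expR (- x) = y ^+ k].
  exists (expR (- (x / k%:R))); split => //; first exact: expR_gt0.
  by rewrite -expRM_natl mulrN mulrCA divff ?mulr1 // pnatr_eq0 -lt0n.
have [yh|yh] := leP (1 / 2) y.
  by apply: le_trans p1 _; rewrite lee_fin; lra.
have qy : q <= y.
  apply: le_trans qA _; rewrite yk; case: k k0 Ak {yk} y0 yh => // k _ Ak y0 yh.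
  have H : 2 ^+ k * y ^+ k <= 1.
    by rewrite -exprMn exprn_ile1 //; [rewrite mulr_ge0 // ltW | lra].
  have A2 : A <= 2 ^+ k by move: Ak; rewrite exprS ler_pM2l.
  rewrite exprS mulrCA; rewrite ler_piMr ?(ltW y0) //.
  by apply: le_trans H; rewrite ler_wpM2r // exprn_ge0 // ltW.
have [] := (le_lt_trans qy yh, pq) => h /(_ h) pq'.
by apply: le_trans pq' _; rewrite lee_fin; lra.
Qed.

(** * Layers and metric of the parameter tuple *)

Section Params.
Variables (R : realType) (L n : nat) (ns : nat -> nat).
Local Notation params := (Params R L n ns).
Implicit Types p q : params.

(** Extension by zero beyond layer [L], in the form [Zl] expects; matching on [idP] supplies the
    proof that builds the ordinal. *)
Definition param_W p (l : nat) : 'M[R]_(ns l.+1, ns l) :=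
  match @idP (l < L)%N with
  | ReflectT lL => (p.2 (Ordinal lL)).1
  | ReflectF _ => 0
  end.

Definition param_B p (l : nat) : 'cV[R]_(ns l.+1) :=
  match @idP (l < L)%N with
  | ReflectT lL => (p.2 (Ordinal lL)).2
  | ReflectF _ => 0
  end.

Lemma param_WE p (l : 'I_L) : param_W p l = (p.2 l).1.
Proof.
case: l => l lL; rewrite /param_W /=; case: {-}_ / idP => [lL'|//].
by rewrite (bool_irrelevance lL' lL).
Qed.

Lemma param_BE p (l : 'I_L) : param_B p l = (p.2 l).2.
Proof.
case: l => l lL; rewrite /param_B /=; case: {-}_ / idP => [lL'|//].
by rewrite (bool_irrelevance lL' lL).
Qed.

Lemma params_dist_sym p q : params_dist p q = params_dist q p.
Proof. by rewrite !params_distE -l2N; apply: eq_l2 => i; rewrite opprB. Qed.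

Lemma params_dist_refl p : params_dist p p = 0.
Proof.
by rewrite params_distE /l2 big1 ?sqrtr0 // => i _; rewrite subrr expr0n.
Qed.

Lemma params_dist_triangle p q r : params_dist p r <= params_dist p q + params_dist q r.
Proof.
rewrite !params_distE; apply: le_trans (ler_l2D _ _).
by rewrite (eq_l2 (g := fun i => param_coord p i - param_coord q i +
  (param_coord q i - param_coord r i))) // => i; rewrite subrKA.
Qed.

Lemma hsnorm_X_dist p q : hsnorm (p.1 - q.1) <= params_dist p q.
Proof.
rewrite ler_wsqrtr // lerDl sumr_ge0 // => l _.
by rewrite addr_ge0 ?hs2_ge0.
Qed.

Lemma hsnorm_WB_dist p q (l : 'I_L) :
  hsnorm ((p.2 l).1 - (q.2 l).1) <= params_dist p q /\
  hsnorm ((p.2 l).2 - (q.2 l).2) <= params_dist p q.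
Proof.
have H : hs2 ((p.2 l).1 - (q.2 l).1) + hs2 ((p.2 l).2 - (q.2 l).2) <=
    hs2 (p.1 - q.1) +
    \sum_(l < L) (hs2 ((p.2 l).1 - (q.2 l).1) + hs2 ((p.2 l).2 - (q.2 l).2)).
  rewrite (bigD1 l) //= addrCA lerDl addr_ge0 ?hs2_ge0 // sumr_ge0 // => k _.
  by rewrite addr_ge0 ?hs2_ge0.
by split; rewrite ler_wsqrtr //; apply: le_trans H; rewrite ?lerDl ?lerDr hs2_ge0.
Qed.

End Params.

Lemma centered_sum d (Omega : measurableType d) (R : realType) (P : probability Omega R)
  (J : finType) (f : J -> Omega -> R) (c : J -> R) :
  (forall j, centered_rv P (f j)) -> centered_rv P (fun w => \sum_j f j w * c j).
Proof.
move=> H.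
have E : (fun w => (\sum_j f j w * c j)%:E) = (fun w => (\sum_j ((c j)%:E * (f j w)%:E))%E).
  by apply/funext => w; rewrite -sumEFin; apply: eq_bigr => j _; rewrite -EFinM mulrC.
have I j : P.-integrable setT (fun w => ((c j)%:E * (f j w)%:E)%E).
  by apply: integrableZl => //; exact: (H j).1.
split; rewrite E; first by apply: integrable_sum.
rewrite integral_sum //; rewrite big1 // => j _.
by rewrite integralZl //; [rewrite (H j).2 mule0 | exact: (H j).1].
Qed.

Lemma measurable_lip_comp d (Omega : measurableType d) (R : realType) (s : R -> R) (lam : R)
  (f : Omega -> R) : 0 < lam -> (forall x y, `|s x - s y| <= lam * `|x - y|) ->
  measurable_fun setT f -> measurable_fun setT (fun w => s (f w)).
Proof.
move=> l0 ls mf.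
apply: (@lipschitz_measurable _ _ _ _ (fun x y : R => `|x - y|) f _ s lam l0 ls).
(* The real line is treated as a space with the single coordinate [tt]. *)
move=> F lF; apply: (@measurable_lipschitz _ _ _ _ unit (fun x _ => x) (fun g => g tt)).
- by move=> g [].
- by [].
- move=> p q; apply: le_trans (lF p q) _.
  exact: (normr_le_l2 (fun _ : unit => p - q) tt).
Qed.

Lemma mem_bigsetU (T : Type) (J : finType) (Q : pred J) (A : J -> set T) j w :
  Q j -> A j w -> (\big[setU/set0]_(i | Q i) A i) w.
Proof. by move=> Qj Aj; rewrite (bigD1 j) //=; left. Qed.

(** * Tail bounds for the random parameters *)

Section Model.
Variables (R : realType) (L : nat) (rho lam tau alpha beta eta : R).
Context d (Omega : measurableType d) (P : probability Omega R).
Variables (n : nat) (ns : nat -> nat) (X : Omega -> 'M[R]_(ns 0, n)).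
Variables (W : forall l : nat, Omega -> 'M[R]_(ns l.+1, ns l)).
Variables (B : forall l : nat, Omega -> 'cV[R]_(ns l.+1)) (sigma : nat -> R -> R).
Hypotheses (rho_gt0 : 0 < rho) (lam_gt0 : 0 < lam) (tau_ge0 : 0 <= tau).
Hypothesis model : model_assumptions L rho lam tau alpha beta eta P X W B sigma.

Let Y w : Params R L n ns := (X w, fun l : 'I_L => (W l w, B l w)).

Lemma measurable_ZL_entry i j : measurable_fun setT (fun w => ZL L X W B sigma w i j).
Proof.
have [_ [_ [mX [mWB [_ [_ [_ [sl _]]]]]]]] := model.
rewrite /ZL; move: i j; suff H l : (l <= L)%N -> forall i j,
  measurable_fun setT (fun w => Zl sigma (X w) (fun l => W l w) (fun l => B l w) l i j).
  exact: H.
elim: l => [|l IH] lL i j /=.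
  under eq_fun do rewrite mxE.
  by apply: measurable_funM => //; exact: mX.
under eq_fun do rewrite mxE; apply: measurable_funM => //.
under eq_fun do rewrite mxE.
apply: (measurable_lip_comp lam_gt0 (sl _ lL).1).
under eq_fun do rewrite !mxE.
apply: measurable_funD; apply: measurable_sum => k.
  by apply: measurable_funM; [exact: (mWB _ lL).1 | exact: IH (ltnW lL) _ _].
by apply: measurable_funM; [exact: (mWB _ lL).2 | exact: measurable_cst].
Qed.

Lemma measurable_lip_ZL (F : 'M[R]_(ns L, n) -> R) :
  (forall x y, `|F x - F y| <= hsnorm (x - y)) ->
  measurable_fun setT (fun w => F (ZL L X W B sigma w)).
Proof.
move=> lF; apply: (@measurable_lipschitz _ _ _ 'M[R]_(ns L, n) ('I_(ns L) * 'I_n)%type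
  (fun A ij => A ij.1 ij.2) (fun f => \matrix_(i, j) f (i, j)) (ZL L X W B sigma) F).
- by move=> f [i j]; rewrite mxE.
- by move=> ij; exact: measurable_ZL_entry.
- by move=> p q; apply: le_trans (lF p q) _; rewrite hsnormE; apply: ler_l2 => ij; rewrite !mxE.
Qed.

Lemma measurable_lip_params (F : Params R L n ns -> R) :
  (forall p q, `|F p - F q| <= params_dist p q) -> measurable_fun setT (fun w => F (Y w)).
Proof.
have [_ [_ [mX [mWB _]]]] := model.
move=> lF; apply: (measurable_lipschitz (@param_of_coordK R L n ns)).
  case=> [[i j]|[l [[i j]|i]]] /=; first exact: mX.
  - exact: (mWB _ (ltn_ord l)).1.
  - exact: (mWB _ (ltn_ord l)).2.
by move=> p q; rewrite -params_distE.
Qed.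

Lemma X_tail (s : R) : 0 < s ->
  (P [set w | (12 * rho * Num.sqrt (ns 0 * n)%:R + s <= hsnorm (X w))%R]
     <= (2 * expR (- (s ^+ 2 / rho ^+ 2)))%:E)%E.
Proof.
have [_ [_ [_ [_ [conc [cX _]]]]]] := model.
move=> s0; have := @l2_concentration _ _ _ P _ _ _ _ rho_gt0 measurable_lip_params conc
  ('I_(ns 0) * 'I_n)%type (fun ij p => p.1 ij.1 ij.2) s _ _ s0.
rewrite card_prod !card_ord; under eq_set do rewrite -hsnormE; apply.
- move=> p q; apply: le_trans (hsnorm_X_dist p q); rewrite hsnormE.
  by apply: ler_l2 => ij; rewrite !mxE.
- by move=> ij; exact: cX.
Qed.

Lemma B_tail (l : 'I_L) (s : R) : 0 < s ->
  (P [set w | (12 * rho * Num.sqrt (ns l.+1)%:R + s <= hsnorm (B l w))%R]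
     <= (2 * expR (- (s ^+ 2 / rho ^+ 2)))%:E)%E.
Proof.
have [_ [_ [_ [_ [conc [_ [cWB _]]]]]]] := model.
move=> s0; have := @l2_concentration _ _ _ P _ _ _ _ rho_gt0 measurable_lip_params conc
  'I_(ns l.+1) (fun i p => (p.2 l).2 i 0) s _ _ s0.
rewrite card_ord; under eq_set do rewrite -hsnorm_cvE; apply.
- move=> p q; apply: le_trans (hsnorm_WB_dist p q l).2; rewrite hsnorm_cvE.
  by apply: ler_l2 => ij; rewrite !mxE.
- by move=> i; exact: (cWB _ (ltn_ord l)).2.
Qed.

(** For a fixed [v] in the unit ball, [W l *m v] is 1-Lipschitz in the parameters, and its entries
    are centered as linear combinations of entries of [W l]. *)
Lemma Wv_tail (l : 'I_L) (v : 'cV[R]_(ns l)) (s : R) : 0 < s -> hsnorm v <= 1 ->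
  (P [set w | (12 * rho * Num.sqrt (ns l.+1)%:R + s <= hsnorm (W l w *m v))%R]
     <= (2 * expR (- (s ^+ 2 / rho ^+ 2)))%:E)%E.
Proof.
have [_ [_ [_ [_ [conc [_ [cWB _]]]]]]] := model.
move=> s0 v1; have := @l2_concentration _ _ _ P _ _ _ _ rho_gt0 measurable_lip_params conc
  'I_(ns l.+1) (fun i p => ((p.2 l).1 *m v) i 0) s _ _ s0.
rewrite card_ord; under eq_set do rewrite -hsnorm_cvE; apply.
- move=> p q; apply: le_trans (hsnorm_WB_dist p q l).1.
  apply: (@le_trans _ _ (hsnorm (((p.2 l).1 - (q.2 l).1) *m v))).
    by rewrite hsnorm_cvE mulmxBl; apply: ler_l2 => ij; rewrite !mxE.
  by apply: le_trans (hsnorm_mul _ _) _; rewrite ler_piMr ?hsnorm_ge0.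
- move=> i; have := centered_sum (fun j => v j 0) (fun j => (cWB _ (ltn_ord l)).1 i j).
  by congr centered_rv; apply/funext => w; rewrite /= mxE.
Qed.

Variables (K delta2 : R).
Hypotheses (K_ge1 : 1 <= K) (K_rho : 48 * rho <= K) (K_beta : 192 * beta * rho ^+ 2 <= K ^+ 2).
Hypotheses (delta2_gt0 : 0 < delta2) (alpha_delta2 : alpha <= delta2).
Hypothesis eta_delta2 : 1 <= eta * delta2.

Let err : R := 2 * expR (- (K ^+ 2 * n%:R / (32 * rho ^+ 2 * delta2))).
Let thr (r : nat) : R := 12 * rho * Num.sqrt r%:R + K * Num.sqrt r%:R / 4.

(** By [K_rho] the median term takes at most a quarter of [K sqrt r] and the slack another quarter.
    Only half is allowed because [net_opnorm] loses a factor 2. *)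
Lemma thr_le r : thr r <= K * Num.sqrt r%:R / 2.
Proof.
have : 0 <= Num.sqrt r%:R :> R by apply: sqrtr_ge0.
by move=> /(ler_wpM2r)/(_ _ _ K_rho); rewrite /thr; lra.
Qed.

(** The tail exponent is twice [K^2 r / (32 rho^2)]. One half absorbs the entropy [c]; the other
    dominates the exponent of [err] because [n <= r delta2]. *)
Lemma tail_exponent_le (r : nat) (c : R) : n%:R <= r%:R * delta2 ->
  c <= K ^+ 2 * r%:R / (32 * rho ^+ 2) ->
  expR c * (2 * expR (- ((K * Num.sqrt r%:R / 4) ^+ 2 / rho ^+ 2))) <= err.
Proof.
move=> nr cK; rewrite mulrCA -expRD ler_pM2l // ler_expR.
have r2 : 0 < rho ^+ 2 by rewrite exprn_gt0.
have -> : (K * Num.sqrt r%:R / 4) ^+ 2 / rho ^+ 2 = 2 * (K ^+ 2 * r%:R / (32 * rho ^+ 2)).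
  rewrite !exprMn sqr_sqrt_nat; field; rewrite gt_eqF //.
have : K ^+ 2 * n%:R / (32 * rho ^+ 2 * delta2) <= K ^+ 2 * r%:R / (32 * rho ^+ 2).
  rewrite ler_pdivrMr ?mulr_gt0 //.
  have -> : K ^+ 2 * r%:R / (32 * rho ^+ 2) * (32 * rho ^+ 2 * delta2) = K ^+ 2 * (r%:R * delta2).
    by field; rewrite gt_eqF.
  by rewrite ler_wpM2l // sqr_ge0.
by move: cK; lra.
Qed.

Lemma tail_le (r : nat) : n%:R <= r%:R * delta2 ->
  2 * expR (- ((K * Num.sqrt r%:R / 4) ^+ 2 / rho ^+ 2)) <= err.
Proof.
move=> nr; have := @tail_exponent_le r 0 nr; rewrite expR0 mul1r; apply.
by apply: divr_ge0; apply: mulr_ge0 => //; exact: sqr_ge0.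
Qed.

Lemma width_ge (l : 'I_L) : n%:R <= (ns l.+1)%:R * delta2.
Proof.
have [_ [ns0 [_ [_ [_ [_ [_ [_ [al _]]]]]]]]] := model.
have := al l.+1 (ltn_ord l); rewrite ler_pdivrMr ?ltr0n; last exact: ns0 (ltn_ord l).
move=> /le_trans; apply; rewrite mulrC; apply: ler_wpM2l; first exact: ler0n.
exact: alpha_delta2.
Qed.

Lemma expR6_ge : 64%:R <= expR 6 :> R.
Proof.
have -> : 6 = 6%:R * 1 :> R by rewrite mulr1.
rewrite expRM_natl.
have -> : 64%:R = 2 ^+ 6 :> R by rewrite -natrX.
by rewrite lerXn2r ?nnegrE ?expR_ge0 //; apply: le_trans (expR_ge1Dx _); lra.
Qed.

(** * The exceptional event *)

Let BadX := [set w | thr (ns 0 * n) <= hsnorm (X w)].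
Let BadB (l : 'I_L) := [set w | thr (ns l.+1) <= hsnorm (B l w)].
Let BadWz (l : 'I_L) (z : net_index (ns l)) :=
  [set w | thr (ns l.+1) <= hsnorm (W l w *m net_pt R z)].
Let BadW (l : 'I_L) := \big[setU/set0]_(z in net_good (c := ns l)) BadWz z.
Let Bad := BadX `|` \big[setU/set0]_(l < L) (BadB l `|` BadW l).

Let K_gt0 : 0 < K. Proof. exact: lt_le_trans K_ge1. Qed.

Lemma thr_slack_gt0 r : (0 < r)%N -> 0 < K * Num.sqrt r%:R / 4.
Proof. by move=> r0; rewrite !mulr_gt0 ?invr_gt0 ?sqrtr_gt0 ?ltr0n ?K_gt0. Qed.

Lemma measurable_hsnorm p q (A : Omega -> 'M[R]_(p, q)) :
  (forall i j, measurable_fun setT (fun w => A w i j)) ->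
  measurable_fun setT (fun w => hsnorm (A w)).
Proof.
move=> mA; under eq_fun do rewrite hsnormE.
by apply: (measurable_l2 (f := fun ij w => A w ij.1 ij.2)) => ij; exact: mA.
Qed.

Lemma measurable_BadX : measurable BadX.
Proof.
have [_ [_ [mX _]]] := model.
by apply: measurable_ge; exact: measurable_hsnorm.
Qed.

Lemma measurable_BadB l : measurable (BadB l).
Proof.
have [_ [_ [_ [mWB _]]]] := model.
by apply: measurable_ge; apply: measurable_hsnorm; exact: (mWB _ (ltn_ord l)).2.
Qed.

Lemma measurable_BadWz l z : measurable (@BadWz l z).
Proof.
have [_ [_ [_ [mWB _]]]] := model.
apply: measurable_ge; apply: measurable_hsnorm => i j.
under eq_fun do rewrite mxE.
by apply: measurable_sum => k; apply: measurable_funM => //; exact: (mWB _ (ltn_ord l)).1.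
Qed.

Lemma measurable_BadW l : measurable (BadW l).
Proof. by apply: bigsetU_measurable => z _; exact: measurable_BadWz. Qed.

Lemma measurable_BadBW l : measurable (BadB l `|` BadW l).
Proof. by apply: measurableU; [exact: measurable_BadB | exact: measurable_BadW]. Qed.

Lemma measurable_Bad : measurable Bad.
Proof.
apply: measurableU; first exact: measurable_BadX.
by apply: bigsetU_measurable => l _; exact: measurable_BadBW.
Qed.

Lemma prob_BadX : (P BadX <= err%:E)%E.
Proof.
have [n0 [ns0 [_ [_ [_ [_ [_ [_ [_ [_ en0]]]]]]]]]] := model.
have n0n : (0 < ns 0 * n)%N by rewrite muln_gt0 n0 ns0.
apply: le_trans (X_tail (thr_slack_gt0 n0n)) _.
rewrite lee_fin; apply: tail_le.
rewrite natrM mulrAC ler_peMl ?ler0n //; apply: le_trans eta_delta2 _.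
by rewrite ler_wpM2r // ltW.
Qed.

Lemma prob_BadB l : (P (BadB l) <= err%:E)%E.
Proof.
have [n0 [ns0 _]] := model.
apply: le_trans (B_tail l (thr_slack_gt0 (ns0 _ (ltn_ord l)))) _.
by rewrite lee_fin; apply: tail_le; exact: width_ge.
Qed.

Lemma prob_BadW l : (P (BadW l) <= err%:E)%E.
Proof.
have [n0 [ns0 [_ [_ [_ [_ [_ [_ [_ [be _]]]]]]]]]] := model.
set b := 2 * expR (- ((K * Num.sqrt (ns l.+1)%:R / 4) ^+ 2 / rho ^+ 2)).
have Hz z : z \in net_good (c := ns l) -> (P (@BadWz l z) <= b%:E)%E.
  move=> zg; apply: (Wv_tail (thr_slack_gt0 (ns0 _ (ltn_ord l)))).
  by apply: net_pt_norm => //; apply: ns0; exact: ltnW (ltn_ord l).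
apply: le_trans (prob_bigsetU_le _ (@measurable_BadWz l) Hz) _.
rewrite lee_fin sumr_const -mulr_natl.
have b0 : 0 <= b by rewrite mulr_ge0 ?expR_ge0.
(* The net has at most [64^(n_l) <= exp (6 n_l)] points. Since [n_l <= beta n_(l+1)], this entropy
   fits into half of the exponent exactly when [192 beta rho^2 <= K^2]. *)
apply: (@le_trans _ _ (expR (6 * (ns l)%:R) * b)).
  rewrite ler_wpM2r //; apply: le_trans (net_card R _) _.
  by rewrite mulrC expRM_natl lerXn2r ?nnegrE ?expR_ge0 ?expR6_ge.
apply: tail_exponent_le; first exact: width_ge.
have r0 : 0 < (ns l.+1)%:R :> R by rewrite ltr0n; exact: ns0 (ltn_ord l).
have := be l.+1 (ltn_ord l); rewrite /= ler_pdivrMr // => cb.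
have r2 : 0 < 32 * rho ^+ 2 by rewrite mulr_gt0 ?exprn_gt0.
rewrite ler_pdivlMr //; have := ler_wpM2r (ltW r0) K_beta; have := ler_wpM2r (ltW r2) cb.
by lra.
Qed.

Lemma prob_Bad : (P Bad <= ((2 * L%:R + 1) * err)%:E)%E.
Proof.
apply: le_trans (measureU2 _ measurable_BadX _) _.
  by apply: bigsetU_measurable => l _; exact: measurable_BadBW.
have -> : (2 * L%:R + 1) * err = err + \sum_(l < L) (err + err).
  by rewrite sumr_const card_ord -mulr_natl; ring.
rewrite EFinD; apply: leeD; first exact: prob_BadX.
apply: prob_bigsetU_le => l; first exact: measurable_BadBW.
move=> _; apply: le_trans (measureU2 _ (measurable_BadB l) (measurable_BadW l)) _.
by rewrite EFinD; apply: leeD; [exact: prob_BadB|exact: prob_BadW].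
Qed.

Definition good_params : set (Params R L n ns) :=
  [set p | bounded_params L K p.1 (param_W p) (param_B p)].

(** The Lipschitz extension requires a base point; zero parameters provide one. *)
Lemma good_params_neq0 : good_params !=set0.
Proof.
have K0 := ltW K_gt0.
exists (0, fun=> (0, 0)); rewrite /good_params /=; split.
  by rewrite hsnorm0 mulr_ge0 ?sqrtr_ge0.
move=> l lL; rewrite (param_WE _ (Ordinal lL)) (param_BE _ (Ordinal lL)) /=.
split; last by rewrite hsnorm0 mulr_ge0 ?sqrtr_ge0.
by move=> v; rewrite mul0mx hsnorm0 !mulr_ge0 ?sqrtr_ge0 ?hsnorm_ge0.
Qed.

Lemma notin_Bad_good w : ~ Bad w -> good_params (Y w).
Proof.
move=> nB; have [_ [ns0 _]] := model.
have lt_thr r x : ~ (thr r <= x) -> x <= K * Num.sqrt r%:R / 2.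
  by move=> /negP; rewrite -ltNge => /ltW/le_trans; apply; exact: thr_le.
have half r : K * Num.sqrt r%:R / 2 <= K * Num.sqrt r%:R.
  have : 0 <= K * Num.sqrt r%:R by rewrite mulr_ge0 ?sqrtr_ge0 // ltW // K_gt0.
  by lra.
split.
  by apply: le_trans (half _); apply: lt_thr => h; apply: nB; left.
move=> l lL; rewrite (param_WE _ (Ordinal lL)) (param_BE _ (Ordinal lL)) /=.
have nBl : ~ (BadB (Ordinal lL) `|` BadW (Ordinal lL)) w.
  move=> h; apply: nB; right; exact: (mem_bigsetU (j := Ordinal lL)).
split; last first.
  by apply: le_trans (half _); apply: lt_thr => h; apply: nBl; left.
move=> v; have -> : K * Num.sqrt (ns l.+1)%:R = 2 * (K * Num.sqrt (ns l.+1)%:R / 2) by lra.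
apply: net_opnorm; first by apply: ns0; exact: ltnW.
move=> z zg; apply: lt_thr => h; apply: nBl; right.
exact: (mem_bigsetU (j := z)).
Qed.

Definition output (p : Params R L n ns) : 'M[R]_(ns L, n) :=
  Zl sigma p.1 (param_W p) (param_B p) L.

Lemma output_ZL w : output (Y w) = ZL L X W B sigma w.
Proof.
apply: eq_Zl => l lL.
by rewrite (param_WE _ (Ordinal lL)) (param_BE _ (Ordinal lL)).
Qed.

Let lip : R := (4 * (1 + lam + tau)) ^+ L * K ^+ L * Num.sqrt delta2.

Lemma output_lipschitz p q : good_params p -> good_params q ->
  hsnorm (output p - output q) <= lip * params_dist p q.
Proof.
move=> gp gq.
have [_ [ns0 [_ [_ [_ [_ [_ [sl [al [_ en0]]]]]]]]]] := model.
rewrite /lip -mulrA; apply: (hsnorm_Zl_lip (L := L)) => //.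
- rewrite -sqrtrV ?ler0n // ler_wsqrtr // -[leRHS]mul1r.
  have np : 0 < (ns 0)%:R :> R by rewrite ltr0n ns0.
  rewrite -[_^-1]mul1r ler_pdivrMr // mul1r mulrC; apply: le_trans eta_delta2 _.
  by rewrite ler_wpM2r // ltW.
- move=> l lL; rewrite -sqrtrV ?ler0n // -sqrtrM ?ler0n // ler_wsqrtr //.
  exact: le_trans (al _ lL) alpha_delta2.
- exact: hsnorm_X_dist.
- move=> l lL; rewrite !(param_WE _ (Ordinal lL)) !(param_BE _ (Ordinal lL)).
  exact: hsnorm_WB_dist.
Qed.

Lemma lip_gt0 : 0 < lip.
Proof.
by rewrite !mulr_gt0 ?exprn_gt0 ?mulr_gt0 ?sqrtr_gt0 ?K_gt0 // ltr_pwDl // addr_gt0.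
Qed.

Lemma ZL_deviation (F : 'M[R]_(ns L, n) -> R) (m t : R) :
  (forall x y, `|F x - F y| <= hsnorm (x - y)) ->
  is_median P (fun w => F (ZL L X W B sigma w)) m -> 0 < t ->
  let q := (2 * L%:R + 1) * err + 2 * expR (- ((t / 2 / lip) ^+ 2 / rho ^+ 2)) in
  q < 1 / 2 -> (P [set w | (t <= `|F (ZL L X W B sigma w) - m|)%R] <= q%:E)%E.
Proof.
move=> lF med t0 q qh.
have [_ [_ [_ [_ [conc _]]]]] := model.
have FE : (fun w => F (ZL L X W B sigma w)) = (fun w => (F \o output) (Y w)).
  by apply/funext => w /=; rewrite output_ZL.
have -> : [set w | t <= `|F (ZL L X W B sigma w) - m|] = [set w | t <= `|(F \o output) (Y w) - m|].
  by apply/seteqP; split=> w /=; rewrite output_ZL.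
rewrite FE in med.
apply: (local_lipschitz_concentration measurable_lip_params conc
  (@params_dist_triangle R L n ns) (@params_dist_sym R L n ns) (@params_dist_refl R L n ns)
  lip_gt0 good_params_neq0 _ _ measurable_Bad notin_Bad_good prob_Bad) => //.
  by move=> p1 p2 g1 g2; apply: le_trans (lF _ _) (output_lipschitz g1 g2).
by rewrite -FE; exact: measurable_lip_ZL.
Qed.

End Model.

(** * Choice of the constants and the bounded case *)

Lemma valid_c_le (R : realType) (L : nat) (rho lam tau alpha beta eta c c' : R) :
  c' <= c -> valid_c L rho lam tau alpha beta eta c ->
  valid_c L rho lam tau alpha beta eta c'.
Proof.
move=> cc H d Omega P n ns X W B sigma model F lF m med t t0.
apply: le_trans (H _ _ _ _ _ _ _ _ _ model F lF m med t t0) _.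
by rewrite lee_fin ler_pM2l // ler_expR lerN2 ler_wpM2r ?minexp_ge0.
Qed.

Lemma valid_c'_le (R : realType) (L : nat) (rho lam tau kappa alpha beta eta c c' : R) :
  c' <= c -> valid_c' L rho lam tau kappa alpha beta eta c ->
  valid_c' L rho lam tau kappa alpha beta eta c'.
Proof.
move=> cc H d Omega P n ns X W B sigma model bs F lF m med t t0.
apply: le_trans (H _ _ _ _ _ _ _ _ _ model bs F lF m med t t0) _.
by rewrite lee_fin ler_pM2l // ler_expR lerN2 ler_wpM2r ?sqr_ge0.
Qed.

(** The constant [c0] is chosen before [alpha] and [eta], which enter only through [delta2]; the
    explicit factor [1 / delta2] later yields the divergence. *)
Lemma valid_c_scaled (R : realType) (L : nat) (rho lam tau beta : R) :
  0 < rho -> 0 < lam -> 0 <= tau -> 0 < beta ->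
  exists2 c0 : R, 0 < c0 & forall alpha eta delta2, 0 < delta2 -> alpha <= delta2 ->
    1 <= eta * delta2 -> valid_c L rho lam tau alpha beta eta (c0 / delta2).
Proof.
move=> rho0 lam0 tau0 beta0.
(* The sum meets all lower bounds imposed on the radius at once; the quadratic one follows since
   [K0 <= K <= K^2]. *)
pose K0 := 1 + 48 * rho + 192 * beta * rho ^+ 2.
have r2 : 0 < rho ^+ 2 by rewrite exprn_gt0.
have br2 : 0 < beta * rho ^+ 2 by rewrite mulr_gt0.
have K01 : 1 <= K0 by rewrite /K0; lra.
have K0r : 48 * rho <= K0 by rewrite /K0; lra.
have K0b : 192 * beta * rho ^+ 2 <= K0 by rewrite /K0; lra.
pose a := 4 * (1 + lam + tau).
have a1 : 1 <= a by rewrite /a; lra.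
(* Up to [delta2], this dominates both denominators: [32 rho^2] from the exceptional event and
   [4 rho^2 a^(2L)] from the Lipschitz part at [t / 2]. *)
pose D := 32 * rho ^+ 2 * a ^+ (2 * L).
have aL : 1 <= a ^+ (2 * L) by rewrite exprn_ege1.
have D0 : 0 < D by rewrite /D !mulr_gt0 //; apply: lt_le_trans aL.
pose g := K0 ^+ (2 * L).
have g0 : 0 < g by rewrite exprn_gt0 //; apply: lt_le_trans K01.
(* The total prefactor is [2 (2L + 1) + 2 = 4L + 4], and [N], its double, satisfies [N <= 2^N] as
   [absorb_prefactor] demands. *)
pose N := (2 * (4 * L + 4))%N.
have N0 : 0 < N%:R :> R by rewrite ltr0n /N muln_gt0 addn_gt0 orbT.
exists ((g * D * N%:R)^-1); first by rewrite invr_gt0; apply: mulr_gt0 => //; exact: mulr_gt0.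
move=> alpha eta delta2 d0 ad ed d Omega P n ns X W B sigma model F lF m med t t0.
have [n0 _] := model.
have [K KK [H1 H2]] := balanced_radius L t0 n0 K01.
have K1 : 1 <= K by apply: le_trans KK.
have Kp : 0 < K by apply: lt_le_trans K1.
have Kr := le_trans K0r KK.
have Kb : 192 * beta * rho ^+ 2 <= K ^+ 2.
  by apply: le_trans K0b _; apply: le_trans KK _; rewrite expr2 ler_peMl // ltW.
have dev := ZL_deviation rho0 lam0 tau0 model K1 Kr Kb d0 ad ed lF med t0.
have mg0 : 0 <= minexp L n t / g by apply: divr_ge0; [exact: minexp_ge0 | exact: ltW].
have iD0 : 0 <= (D * delta2)^-1 by rewrite invr_ge0 ltW // mulr_gt0.
pose x := minexp L n t / g / (D * delta2).
have -> : (g * D * N%:R)^-1 / delta2 * minexp L n t = x / N%:R.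
  by rewrite /x; field; rewrite !gt_eqF.
apply: (absorb_prefactor (A := 4 * L%:R + 4)) dev _ _ _.
- apply: probability_le1; apply: measurable_ge; apply: measurableT_comp => //.
  by apply: measurable_funB => //; exact: measurable_lip_ZL lam0 model _ lF.
- have e1 : expR (- (K ^+ 2 * n%:R / (32 * rho ^+ 2 * delta2))) <= expR (- x).
    rewrite ler_expR lerN2 /x; apply: ler_pM => //.
    have rho32 : 0 < 32 * rho ^+ 2 by exact: mulr_gt0.
    rewrite lef_pV2 ?posrE; [|exact: mulr_gt0|exact: mulr_gt0].
    by rewrite ler_pM2r // /D ler_peMr // ltW.
  have e2 : expR (- ((t / 2 / ((4 * (1 + lam + tau)) ^+ L * K ^+ L * Num.sqrt delta2)) ^+ 2 /
      rho ^+ 2)) <= expR (- x).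
    rewrite ler_expR lerN2.
    have -> : (t / 2 / ((4 * (1 + lam + tau)) ^+ L * K ^+ L * Num.sqrt delta2)) ^+ 2 / rho ^+ 2
        = (t ^+ 2 / K ^+ (2 * L)) * (8 / (D * delta2)).
      rewrite -/a /D [a ^+ (2 * L)]exprM [K ^+ (2 * L)]exprM -[in RHS](sqr_sqrtr (ltW d0)).
      rewrite (exprAC a 2 L) (exprAC K 2 L).
      have s0 : Num.sqrt delta2 != 0 by rewrite gt_eqF // sqrtr_gt0.
      have aLn : a ^+ L != 0 by rewrite expf_neq0 // gt_eqF // (lt_le_trans _ a1).
      have KLn : K ^+ L != 0 by rewrite expf_neq0 // gt_eqF.
      move: (a ^+ L) (K ^+ L) (Num.sqrt delta2) aLn KLn s0 => u v s u0 v0 s0.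
      by field; rewrite u0 v0 s0 gt_eqF.
    rewrite /x; apply: ler_pM => //.
    by rewrite ler_peMl //; lra.
  have L0 : 0 <= L%:R :> R by exact: ler0n.
  have L1 : 0 <= 2 * (2 * L%:R + 1) :> R by lra.
  have := ler_wpM2l L1 e1; lra.
- apply: (@le_trans _ _ (N%:R)); first by rewrite /N natrM natrD natrM.
  by rewrite -natrX ler_nat ltnW // ltn_expl.
- by rewrite /N muln_gt0 addn_gt0 orbT.
Qed.

Lemma hsnorm_ZL_le (R : realType) (L n : nat) (ns : nat -> nat) (sigma : nat -> R -> R)
  (X : 'M[R]_(ns 0, n)) (W : forall l : nat, 'M[R]_(ns l.+1, ns l))
  (B : forall l : nat, 'cV[R]_(ns l.+1)) (kappa : R) : (0 < L)%N -> (0 < ns L)%N ->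
  (forall x, `|sigma L.-1 x| <= kappa) ->
  hsnorm (Zl sigma X W B L) <= kappa * Num.sqrt n%:R.
Proof.
case: L => // L _ nL sk /=.
have s0 := sqrt_nat_gt0 R nL.
rewrite hsnormZ ger0_norm ?invr_ge0 ?sqrtr_ge0 // mulrC ler_pdivrMr //.
apply: (@le_trans _ _ (hsnorm (const_mx kappa : 'M[R]_(ns L.+1, n)))).
  rewrite !hsnormE; apply: ler_l2 => ij; rewrite !mxE.
  by apply: le_trans (sk _) (ler_norm _).
rewrite hsnorm_const sqrt_natM ger0_norm; last exact: le_trans (sk 0).
by rewrite mulrC -mulrA [_ * Num.sqrt n%:R]mulrC.
Qed.

Lemma median_attained d (Omega : measurableType d) (R : realType) (P : probability Omega R)
  (f : Omega -> R) (m : R) : is_median P f m ->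
  (exists w, f w <= m) /\ (exists w, m <= f w).
Proof.
have ne (A : set Omega) : ((1 / 2)%:E <= P A)%E -> exists w, A w.
  move=> h; apply/not_existsP => nA; move: h.
  have -> : A = set0 by apply/seteqP; split=> // w /nA.
  by rewrite measure0 lee_fin; lra.
by move=> [/ne h1 /ne h2].
Qed.

Lemma valid_c'_of_valid_c (R : realType) (L : nat) (rho lam tau kappa alpha beta eta c : R) :
  0 <= c -> valid_c L rho lam tau alpha beta eta c ->
  valid_c' L rho lam tau kappa alpha beta eta (c / (4 * kappa ^+ 2 + 1)).
Proof.
move=> c0 H d Omega P n ns X W B sigma model bs F lF m med t t0.
have k4 : 0 <= 4 * kappa ^+ 2 by rewrite mulr_ge0 // sqr_ge0.
have kp : 0 < 4 * kappa ^+ 2 + 1 by rewrite ltr_wpDl.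
have [n0 [ns0 _]] := model.
have nr : 0 <= Num.sqrt n%:R :> R by apply: sqrtr_ge0.
(* Below the threshold [t^2 <= 4 kappa^2 n], so [minexp_ge] applies with [g = 1 / (4 kappa^2 + 1)];
   the added 1 keeps [g] at most 1, also when [kappa = 0]. For [L = 0] there is no activation and no
   threshold. *)
have small : ((0 < L)%N -> t <= 2 * kappa * Num.sqrt n%:R) ->
    (P [set w | (t <= `|F (ZL L X W B sigma w) - m|)%R] <=
      (2 * expR (- (c / (4 * kappa ^+ 2 + 1) * t ^+ 2)))%:E)%E.
  move=> tk; apply: le_trans (H _ _ _ _ _ _ _ _ _ model F lF m med t t0) _.
  rewrite lee_fin ler_pM2l // ler_expR lerN2 -mulrA; apply: ler_wpM2l => //.
  apply: minexp_ge => //.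
    by rewrite invr_ge0 invf_le1 // (ltW kp) lerDr k4.
  move=> L0; rewrite mulrC ler_pdivrMr //.
  have : t ^+ 2 <= (2 * kappa * Num.sqrt n%:R) ^+ 2.
    by rewrite lerXn2r ?nnegrE ?(ltW t0) ?(le_trans (ltW t0) (tk L0)) // tk.
  rewrite !exprMn sqr_sqrt_nat; have : 0 <= n%:R :> R by exact: ler0n.
  lra.
have [L0|L0] := posnP L; first by apply: small; rewrite L0.
have [tk|tk] := leP t (2 * kappa * Num.sqrt n%:R); first exact: small.
(* Beyond the threshold the event is empty: the oscillation of [F (Z_L)] is less than [t], and a
   median lies between two attained values. *)
have dF w w' : F (ZL L X W B sigma w) - F (ZL L X W B sigma w') <= 2 * kappa * Num.sqrt n%:R.
  apply: le_trans (ler_norm _) _; apply: le_trans (lF _ _) _.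
  apply: le_trans (ler_hsnormD _ _) _; rewrite hsnormN.
  have b w0 : hsnorm (ZL L X W B sigma w0) <= kappa * Num.sqrt n%:R.
    by apply: hsnorm_ZL_le => //; [exact: ns0 | exact: bs].
  have := b w; have := b w'; lra.
have [[w1 h1] [w2 h2]] := median_attained med.
rewrite (_ : [set w | _] = set0); first by rewrite measure0 lee_fin mulr_ge0 ?expR_ge0.
apply/seteqP; split=> // w /=; rewrite leNgt => /negP; apply.
apply: le_lt_trans tk; rewrite ler_norml.
have := dF w w1; have := dF w2 w; lra.
Qed.

Theorem theorem3p7 (R : realType) (L : nat)
  (rho lam tau alpha beta eta kappa : R) :
  0 < rho -> 0 < lam -> 0 <= tau -> 0 < alpha -> 0 < beta -> 1 <= eta ->
  (exists c : R, 0 < c /\ valid_c L rho lam tau alpha beta eta c) /\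
  (exists c' : R, 0 < c' /\ valid_c' L rho lam tau kappa alpha beta eta c') /\
  (* divergence of the optimal constants as alpha -> 0, eta -> +oo *)
  (forall M : R, exists a0 : R, 0 < a0 /\ exists e0 : R,
     forall alpha' eta' : R, 0 < alpha' -> alpha' <= a0 -> e0 <= eta' ->
       valid_c L rho lam tau alpha' beta eta' M /\
       valid_c' L rho lam tau kappa alpha' beta eta' M).
Proof.
move=> rho0 lam0 tau0 alpha0 beta0 eta1.
have [c0 c0_gt0 H] := valid_c_scaled L rho0 lam0 tau0 beta0.
pose k := 4 * kappa ^+ 2 + 1.
have k1 : 1 <= k by rewrite /k lerDr mulr_ge0 // sqr_ge0.
have k0 : 0 < k by apply: lt_le_trans k1.
have [c c_gt0 Hc] : exists2 c, 0 < c & valid_c L rho lam tau alpha beta eta c.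
  (* Here [delta2 = alpha + 1], admissible because [eta >= 1]. *)
  exists (c0 / (alpha + 1)); first by rewrite divr_gt0 // addr_gt0.
  apply: H; rewrite ?addr_gt0 ?lerDl //.
  by apply: mulr_ege1; rewrite // lerDr ltW.
split; first by exists c.
split.
  exists (c / k); split; first by rewrite divr_gt0.
  by apply: valid_c'_of_valid_c => //; exact: ltW.
(* Divergence means that every [M] becomes a valid constant. The maximum with 1 ensures positivity,
   and the factor [k] pays for passing to the bounded case. *)
move=> M; pose M' := Num.max M 1 * k.
have M1 : 1 <= Num.max M 1 by rewrite le_max lexx orbT.
have M'0 : 0 < M' by rewrite mulr_gt0 // (lt_le_trans _ M1).
exists (c0 / M'); split; first by rewrite divr_gt0.
(* The threshold for [eta'] is the reciprocal of that for [alpha'], so [delta2 = c0 / M'] satisfies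
   both constraints and the resulting constant is [M']. *)
exists (M' / c0) => alpha' eta' _ al et.
have V : valid_c L rho lam tau alpha' beta eta' M'.
  have -> : M' = c0 / (c0 / M') by rewrite invf_div mulrC divfK // gt_eqF.
  apply: H => //; first by rewrite divr_gt0.
  by rewrite -ler_pdivrMr ?divr_gt0 // invf_div mul1r.
have MM : M <= Num.max M 1 by rewrite le_max lexx.
split.
  apply: valid_c_le V; apply: le_trans MM _.
  by rewrite ler_peMr // (le_trans _ M1).
apply: valid_c'_le MM _; rewrite -[Num.max M 1](mulfK (lt0r_neq0 k0)) -/M'.
by apply: valid_c'_of_valid_c => //; exact: ltW.
Qed.
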